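(* Suppose $f$ and its Euclidean gradient are known, $f$ is gradient $L$-Lipschitz on $\operatorname{Conv}(\widetilde{\mathcal M}\cup\mathcal M)$, $f\ge f^\star>-\infty$ on $\mathcal M\cup\widetilde{\mathcal M}$, and the approximate-retraction domain assumption (see context) holds with radius $Q$. Let $\widetilde{\operatorname{grad}}f(r):=\Pi_{\widetilde T_r\widetilde{\mathcal M}}(\nabla f(r))$, and let $\bar\alpha>0$, $\gamma\in(0,1)$, $\delta\in(0,0.25)$. Consider the algorithm $x_{i+1}:=\widetilde R_{x_i}(-\alpha_i\widetilde{\operatorname{grad}}f(x_i))$ started at $x_0\in\widetilde{\mathcal M}$, where $\alpha_i$ is determined by the backtracking procedure (see context) at $x_i$ with parameters $\gamma,\delta$ and initial step-size $$\widehat\alpha_i:=\min\left\{\bar\alpha,\ \frac{Q}{\|\widetilde{\operatorname{grad}}f(x_i)\|}\right\}>0 .$$ Suppose all iterations are performed at points of $\widetilde{\mathcal M}$ where $\widetilde{\mathcal M}$ is a manifold, $h$ is small enough such that $6L_v\le Q$, and $$\max\left\{\frac{6L_v}{\bar\alpha},\ 2c_{\widetilde{\mathcal M}}\|\nabla f(x_i)\|\sqrt D\,h^m\right\}\le\|\widetilde{\operatorname{grad}}f(x_i)\|$$ holds for all the iterations. Then for any $\varepsilon>0$, provided enough iterations are performed, the algorithm returns a point $x\in\widetilde{\mathcal M}$ satisfying $f(x)\le f(x_0)$ and $$\|\widetilde{\operatorname{grad}}f(x)\|\le\max\left\{\frac{6L_v}{\bar\alpha},\ 2c_{\widetilde{\mathcal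 M}}\|\nabla f(x)\|\sqrt D\,h^m\right\}+\varepsilon=:\varepsilon_4(\widetilde{\mathcal M}).\tag{a}$$ In addition, for the point $p\in\mathcal M$ such that $\mathcal P_m^h(p)=x$, $$\|\operatorname{grad}_{\mathcal M}f(p)\|\le(c_{\mathcal M}G+c_{\mathrm{MMLS}})\sqrt D\,h^m+\varepsilon_4(\widetilde{\mathcal M}),\tag{b}$$ where $\|\nabla f(x)\|\le G$, and $\|p-x\|\le c_{\mathrm{MMLS}}\sqrt D\,h^{m+1}$. Moreover, when $h\to0$ the bound in (b) goes to $\varepsilon$, and the quantities $6L_v$ and $\max\{6L_v/\bar\alpha,\ 2c_{\widetilde{\mathcal M}}\|\nabla f(x_i)\|\sqrt D\,h^m\}$ go to $0$. Finally, if $\varepsilon_4(\widetilde{\mathcal M})>Q\big/\min\{\bar\alpha,\ 2\gamma(0.25-\delta)/\widetilde L\}$, the bounds (a) and (b) are achieved in at most $$\left\lceil\frac{f(x_0)-f^\star}{Q\,\delta}\cdot\frac1{\varepsilon_4(\widetilde{\mathcal M})}\right\rceil$$ iterations, and if $\varepsilon_4(\widetilde{\mathcal M})\le Q\big/\min\{\bar\alpha,\ 2\gamma(0.25-\delta)/\widetilde L\}$, they are achieved in at most $$\left\lceil\frac{f(x_0)-f^\star}{\delta\min\left\{\bar\alpha,\ \frac{2\gamma(0.25-\delta)}{\widetilde L}\right\}}\cdot\frac1{\varepsilon_4(\widetilde{\mathcal M})^2}\right\rceil$$ iterations. Each iteration $i$ requires at most $$\max\left\{1,\ 2+\log_{\gamma^{-1}}\left(\frac{\widehat\alpha_i\,\widetilde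 L}{2\gamma\left(\frac{\beta_i}2-\delta\right)}\right)\right\}$$ retractions and cost function evaluations (assuming $f(x_0)$ and $\widetilde{\operatorname{grad}}f(x_0)$ were already computed), where $\beta_i:=1-\dfrac{c_{\widetilde{\mathcal M}}\|\nabla f(x_i)\|\sqrt D\,h^m}{\|\widetilde{\operatorname{grad}}f(x_i)\|}>0$.
   Context: Norms: $\|\cdot\|$ is the Euclidean norm on vectors and the spectral norm on matrices; $B_\delta(x)$ is the open ball; $\Pi_V$ is orthogonal projection onto $V$. ''Gradient $L$-Lipschitz on $\operatorname{Conv}(\widetilde{\mathcal M}\cup\mathcal M)$'' means $\|\nabla f(y)-\nabla f(x)\|\le L\|y-x\|$ for all $x,y$ in the convex hull of $\widetilde{\mathcal M}\cup\mathcal M$. $f:\mathbb R^D\to\mathbb R$. Setting. $\mathcal M$ ($\in C^2$) is a closed (compact, boundaryless) smooth $d$-dimensional submanifold of $\mathbb R^D$ with positive reach $\mathrm{rch}(\mathcal M)$ (the largest $\tau$ such that every point at distance $<\tau$ from $\mathcal M$ has a unique nearest point in $\mathcal M$). $S=\{r_i\}_{i=1}^n\subset\mathcal M$ is a quasi-uniform sample set with respect to $\mathcal M$: with fill distance $h=\sup_{x\in\mathcal M}\min_i\|x-r_i\|$ and separation radius $\delta_S=\tfrac12\min_{i\ne j}\|r_i-r_j\|$, one has $\delta_S\le h\le c_{qu}\delta_S$ for a constant $c_{qu}>0$. The metric is the standard inner product of $\mathbb R^D$; $\operatorname{grad}_{\mathcal M}f(p)=\Pi_{T_p\mathcal M}(\nabla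 f(p))$, $\operatorname{grad}_{\widetilde{\mathcal M}}f(r)=\Pi_{T_r\widetilde{\mathcal M}}(\nabla f(r))$. MMLS projection of degree $m\ge1$. For $r\in\mathbb R^D$ close to $\mathcal M$: Step 1: $(q(r),H(r))$ minimizes $\sum_i d(r_i-q,H)^2\theta_1(\|r_i-q\|)$ over $q\in\mathbb R^D$ and $d$-dimensional linear subspaces $H\subset\mathbb R^D$, subject to $r-q\perp H$, $q\in B_\mu(r)$, $S\cap B_h(q)\ne\emptyset$. Step 2: let $q_i$ be the orthogonal projection of $r_i-q(r)$ onto $H(r)\simeq\mathbb R^d$; $g^\star(\cdot\,|\,r):H(r)\to\mathbb R^D$ minimizes $\sum_i\|g(q_i)-r_i\|^2\theta_h(\|r_i-q(r)\|)$ over $\mathbb R^D$-valued polynomials of total degree at most $m$. Then $\mathcal P_m^h(r):=g^\star(0\,|\,r)$ and $\widetilde{\mathcal M}:=\{\mathcal P_m^h(p):p\in\mathcal M\}$. Weights: $\theta_1,\theta_h\ge0$, $\theta_h(th)=\Phi(t)$ for a fixed $\Phi$; they are smooth (away from singularities at $0$), monotonically decaying, supported on $[0,c_1h]$ with $c_1>3$, $\theta_1(c_2h)>c_3>0$ and $\theta_h(c_2h)>c_3>0$ for some constants $c_2<c_1$, $\lim_{t\to0}\theta_h(t)=\infty$, and $\mu=\mathrm{rch}(\mathcal M)/2$. It is assumed that there is an $\epsilon$-neighborhood of $\mathcal M$ on which the Step 1 problem has a unique local minimum $q(x)\in B_\mu(x)$; $U_{\mathrm{unique}}$ is the largest such neighborhood.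 $h$ is assumed small enough (including $hL\le1$) for the known facts: $\mathcal P_m^h:\mathcal M\to\widetilde{\mathcal M}$ is a bijection; $\widetilde{\mathcal M}$ is compact and almost everywhere a smooth $d$-dimensional manifold; $\mathcal P_m^h(U_{\mathrm{unique}})\subset\widetilde{\mathcal M}$; if $p\in\mathcal M$, $\mathcal P_m^h(p)=r$, then $q(r)=q(p)$, $H(r)=H(p)$, $g^\star(\cdot|r)=g^\star(\cdot|p)$, $\mathcal P_m^h(r)=r$. Local parametrizations: near $0\in H(p)$, $\varphi$ and $\widetilde\varphi$ are the local parametrizations of $\mathcal M$ and $\widetilde{\mathcal M}$ sending $x$ to the nearby point $y$ of the set for which $y-q(p)$ projects orthogonally onto $x$ in $H(p)$; $\varphi(0)=p$, $\widetilde\varphi(0)=\mathcal P_m^h(p)$. Constants (independent of $p$, $v$): $c_{\mathrm{MMLS}}$ satisfies $\|\mathcal P_m^h(p)-p\|\le c_{\mathrm{MMLS}}\sqrt D\,h^{m+1}$ for all $p\in\mathcal M$; $c_{\mathcal M},c_{\widetilde{\mathcal M}}$ satisfy, for all $p\in\mathcal M$, $x\in B_{c_1h}(0)\subset H(p)$, unit $v\in\mathbb R^d$: $\|\mathrm Dg^\star(x|p)[v]-\mathrm D\varphi(x)[v]\|_\infty\le c_{\mathcal M}h^m$ and $\|\mathrm Dg^\star(x|p)[v]-\mathrm D\widetilde\varphi(x)[v]\|_\infty\le c_{\widetilde{\mathcal M}}h^m$. Approximate components: $\widetilde T_r\widetilde{\mathcal M}:=\operatorname{Range}(\mathrm Dg^\star(0\,|\,r))$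 for $r\in\widetilde{\mathcal M}$; $\widetilde R_r(\xi):=\mathcal P_m^h(r+\xi)$ for $\xi\in\widetilde T_r\widetilde{\mathcal M}$. Approximate-retraction domain assumption: for each $r\in\widetilde{\mathcal M}$ there is $Q_r>0$ with $r+\xi\in U_{\mathrm{unique}}$ for all $\xi\in\widetilde T_r\widetilde{\mathcal M}$, $\|\xi\|\le Q_r$, and $Q:=\inf_rQ_r>0$; $K:=\{(r,\xi):r\in\widetilde{\mathcal M},\xi\in\widetilde T_r\widetilde{\mathcal M},\|\xi\|\le Q\}$ (compact). For $(r,\xi)\in K$, $\mathrm D\widetilde R_r(0_r)[\xi]=\xi+v'_{r,\xi}(0)\in T_r\widetilde{\mathcal M}$, where $v_{r,\xi}(t)\in H(r+t\xi)^\perp$ is smooth in $t$ near $0$ with $t\xi+v_{r,\xi}(t)\in T_r\widetilde{\mathcal M}$; $L_v>0$ is a constant with $\|v'_{r,\xi}(0)\|\le L_v$ on $K$, and $L_v\to0$ as $h\to0$. $\widetilde L>0$ is a constant with $|f(\widetilde R_r(\xi))-[f(r)+\langle\operatorname{grad}_{\widetilde{\mathcal M}}f(r),\xi+v'_{r,\xi}(0)\rangle]|\le\frac{\widetilde L}2\|\xi\|^2$ for all $(r,\xi)\in K$. $G$ is a finite bound of $\|\nabla f\|$ on $\widetilde{\mathcal M}$. Backtracking procedure at $x$ with initial step-size $\widehat\alpha$ and parameters $\gamma,\delta$: set $\alpha\leftarrow\widehat\alpha$; while $f(x)-f(\widetilde R_x(-\alpha\,\widetilde{\operatorname{grad}}f(x)))<\delta\alpha\|\widetilde{\operatorname{grad}}f(x)\|^2$,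 replace $\alpha\leftarrow\gamma\alpha$; return $\alpha$. *)

(* Defs.v *)
(* Points of R^D are row vectors.  The norm `|x| of a row vector is the sup
   norm; the Euclidean norm is enorm below. *)
From HB Require Import structures.
From mathcomp Require Import all_boot all_order all_algebra.
From mathcomp Require Import all_classical all_reals all_analysis.
Set Implicit Arguments.
Unset Strict Implicit.
Unset Printing Implicit Defensive.
Import Order.TTheory GRing.Theory Num.Theory.
Import numFieldNormedType.Exports.
Local Open Scope classical_set_scope.
Local Open Scope ring_scope.

Section Euclidean.
Context {R : realType} {D : nat}.
Implicit Types (x y u v w : 'rV[R]_D) (A N : set 'rV[R]_D).

Definition dot u v : R := (u *m v^T) 0 0.
Definition enorm u : R := Num.sqrt (dot u u).

(* Orthogonal projection onto a linear subspace A (the value is 0 when A is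
   not a subspace and the foot of the perpendicular does not exist). *)
Definition orthproj A x : 'rV[R]_D :=
  xget 0 [set y | A y /\ forall z, A z -> dot (x - y) z = 0].

Definition eball x (r : R) : set 'rV[R]_D := [set y | enorm (y - x) < r].

Definition tube N (r : R) : set 'rV[R]_D :=
  [set x | exists2 y, N y & enorm (x - y) < r].

Definition reach N : \bar R :=
  ereal_sup [set t%:E | t in [set t : R | 0 <= t /\
    forall x, tube N t x ->
      exists! y, N y /\ forall z, N z -> enorm (x - y) <= enorm (x - z)]].

Definition convex_hull A : set 'rV[R]_D :=
  [set x | exists n (a : 'I_n -> R) (y : 'I_n -> 'rV[R]_D),
     [/\ forall i, 0 <= a i, \sum_i a i = 1, forall i, A (y i)
       & x = \sum_i a i *: y i]].

Definition egrad (f : 'rV[R]_D -> R) x : 'rV[R]_D :=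
  \row_i 'D_(delta_mx 0 i) f x.

(* Velocities at p of curves in N; this is the tangent space at every point
   near which N is a submanifold. *)
Definition tangent_space N p : set 'rV[R]_D :=
  [set w | exists c : R -> 'rV[R]_D,
     [/\ \forall t \near 0, N (c t), c 0 = p & is_derive (0 : R) 1 c w]].

Definition rgrad N (f : 'rV[R]_D -> R) p : 'rV[R]_D :=
  orthproj (tangent_space N p) (egrad f p).

(* R^D-valued polynomials of total degree at most m in the coordinates; those
   on a subspace H (that is, on R^d via any linear identification) are their
   restrictions to H. *)
Definition poly_map (m : nat) (g : 'rV[R]_D -> 'rV[R]_D) : Prop :=
  exists c : {ffun 'I_D -> 'I_m.+1} -> 'rV[R]_D, forall x,
    g x = \sum_(a : {ffun 'I_D -> 'I_m.+1} | (\sum_k a k <= m)%N)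
            (\prod_k x 0 k ^+ a k) *: c a.

Definition poly_map_on (m : nat) (H : {vspace 'rV[R]_D})
    (g : 'rV[R]_D -> 'rV[R]_D) : Prop :=
  exists2 G, poly_map m G & forall x, x \in H -> g x = G x.

Definition hausdorff_null (d : nat) A : Prop :=
  forall e : R, 0 < e ->
    exists (I : set nat) (c : nat -> 'rV[R]_D) (r : nat -> R),
      [/\ forall i, I i -> 0 <= r i,
          A `<=` \bigcup_(i in I) [set y | enorm (y - c i) <= r i]
        & (\esum_(i in I) (r i ^+ d)%:E <= e%:E)%E].

End Euclidean.

Fixpoint class_C {R : realType} {V W : normedModType R} (k : nat) (U : set V)
    (f : V -> W) : Prop :=
  match k with
  | 0%N => forall x, U x -> {for x, continuous f}
  | k'.+1 => (forall x, U x -> differentiable f x) /\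
             (forall v, class_C k' U ('D_v f))
  end.

(* Near p, N is a regular level set {F = 0}, where F has values in R^(D-d) and
   is of class C^k for all k in K: K = [set 2] for a C^2 submanifold, setT for
   a smooth one. *)
Definition submanifold_at {R : realType} {D : nat} (K : set nat) (d : nat)
    (N : set 'rV[R]_D) (p : 'rV[R]_D) : Prop :=
  [/\ (d <= D)%N, N p &
   exists (U : set 'rV[R]_D) (F : 'rV[R]_D -> 'rV[R]_(D - d)),
     [/\ open U, U p, forall k, K k -> class_C k U F,
         N `&` U = [set y | U y /\ F y = 0]
       & forall y, N y -> U y -> \rank (jacobian F y) = (D - d)%N]].

(* The data that do not depend on the fill distance h. *)
Record problem (R : realType) (D : nat) := Problem {
  dimM : nat;
  deg : nat;
  mfd : set 'rV[R]_D;
  cost : 'rV[R]_D -> R;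
  lipL : R;
  fstar : R;
  boundG : R;
  Phi : R -> \bar R;
  c1 : R; c2 : R; c3 : R; cqu : R;
  cMMLS : R; cM : R; cMt : R;
  alphabar : R; gamma : R; delta : R }.

(* The data that depend on h: the samples and the objects built from them.
   hatq r, hatH r, gstar r are the outcomes q(r), H(r), g*( . | r) of the two
   minimizations; phi p, phit p are the local parametrizations attached to p,
   of which only the values on H(p) matter (likewise for gstar r and H(r)). *)
Record sampling (R : realType) (D : nat) := Sampling {
  nsamp : nat;
  samp : 'I_nsamp -> 'rV[R]_D;
  fillh : R;
  theta1 : R -> \bar R;
  hatq : 'rV[R]_D -> 'rV[R]_D;
  hatH : 'rV[R]_D -> {vspace 'rV[R]_D};
  gstar : 'rV[R]_D -> 'rV[R]_D -> 'rV[R]_D;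
  phi : 'rV[R]_D -> 'rV[R]_D -> 'rV[R]_D;
  phit : 'rV[R]_D -> 'rV[R]_D -> 'rV[R]_D;
  vcorr : 'rV[R]_D -> 'rV[R]_D -> R -> 'rV[R]_D;
  radQ : R;
  boundLv : R;
  Ltilde : R }.
Arguments samp {R D} s i.

Section MMLS.
Context {R : realType} {D : nat} (P : problem R D) (s : sampling R D).
Implicit Types (p q r x y xi : 'rV[R]_D) (H : {vspace 'rV[R]_D}).

Local Notation d := (dimM P).
Local Notation m := (deg P).
Local Notation M := (mfd P).
Local Notation f := (cost P).
Local Notation h := (fillh s).
Local Notation sqrtD := (Num.sqrt (D%:R : R)).

Definition problem_ok : Prop :=
  [/\ (1 <= m)%N, compact M, (forall p, M p -> submanifold_at [set 2%N] d M p)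
    & (0 < reach M)%E] /\
  [/\ 0 <= lipL P, 3 < c1 P, 0 < c2 P < c1 P, 0 < c3 P & 0 < cqu P] /\
  [/\ 0 <= cMMLS P, 0 <= cM P & 0 <= cMt P] /\
  [/\ 0 < alphabar P, 0 < gamma P < 1 & 0 < delta P < 4^-1].

Definition fill_distance : R :=
  sup [set inf [set enorm (x - samp s i) | i in setT] | x in M].

Definition separation : \bar R :=
  ereal_inf [set (2^-1 * enorm (samp s ij.1 - samp s ij.2))%:E
            | ij in [set ij : 'I_(nsamp s) * 'I_(nsamp s) | ij.1 != ij.2]].

Definition quasi_uniform : Prop :=
  [/\ forall i, M (samp s i), 0 < h, h = fill_distance
    & (separation <= h%:E <= (cqu P)%:E * separation)%E].

(* Weights take the value +oo at a singularity; the costs below then use the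
   convention 0 * +oo = 0 of the extended reals. *)
Definition thetah (t : R) : \bar R := Phi P (t / h).

Definition weight (theta : R -> \bar R) : Prop :=
  [/\ forall t, 0 <= t -> (0 <= theta t)%E,
      (forall t, 0 < t -> theta t \is a fin_num) /\
      (forall k, class_C k [set t : R | 0 < t] (fun t => fine (theta t))),
      forall t u, 0 <= t -> t <= u -> (theta u <= theta t)%E,
      forall t, c1 P * h < t -> theta t = 0%E
    & ((c3 P)%:E < theta (c2 P * h)%R)%E].

Definition weights_ok : Prop :=
  [/\ weight (theta1 s), weight thetah
    & thetah t @[t --> (0 : R)^'+] --> +oo%E].

Definition step1_cost q H : \bar R :=
  (\sum_i (enorm (samp s i - q - orthproj [set` H] (samp s i - q)) ^+ 2)%R%:E *
          theta1 s (enorm (samp s i - q)%R))%E.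

(* The second inequality is |q - r| < mu with mu = reach M / 2 (the reach may
   be +oo). *)
Definition step1_feasible r q H : Prop :=
  [/\ \dim H = d, forall u, u \in H -> dot (r - q) u = 0,
      ((2 * enorm (q - r))%R%:E < reach M)%E
    & exists i, eball q h (samp s i)].

Definition step1_min r q H : Prop :=
  step1_feasible r q H /\
  forall q' H', step1_feasible r q' H' ->
    (step1_cost q H <= step1_cost q' H')%E.

(* q is a local minimum of q |-> min_H (cost). *)
Definition step1_locmin r q : Prop :=
  exists H, step1_feasible r q H /\
    exists2 e : R, 0 < e & forall q' H', step1_feasible r q' H' ->
      eball q e q' -> (step1_cost q H <= step1_cost q' H')%E.

Definition unique_step1 : set 'rV[R]_D := [set r | exists! q, step1_locmin r q].

Definition Uunique : set 'rV[R]_D :=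
  \bigcup_(e in [set e : R | 0 < e /\ tube M e `<=` unique_step1]) tube M e.

Definition step2_cost r (g : 'rV[R]_D -> 'rV[R]_D) : \bar R :=
  (\sum_i (enorm (g (orthproj [set` hatH s r] (samp s i - hatq s r))
                   - samp s i) ^+ 2)%R%:E *
          thetah (enorm (samp s i - hatq s r)%R))%E.

Definition step2_min r (g : 'rV[R]_D -> 'rV[R]_D) : Prop :=
  poly_map_on m (hatH s r) g /\
  forall g', poly_map_on m (hatH s r) g' -> (step2_cost r g <= step2_cost r g')%E.

Definition mmls_ok : Prop :=
  (exists2 e : R, 0 < e & tube M e `<=` unique_step1) /\
  forall r, Uunique r ->
    step1_min r (hatq s r) (hatH s r) /\ step2_min r (gstar s r).

Definition proj r : 'rV[R]_D := gstar s r 0.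

Definition Mt : set 'rV[R]_D := proj @` M.

Definition Mt_smooth_at r : Prop := submanifold_at setT d Mt r.

Definition known_facts : Prop :=
  [/\ h * lipL P <= 1,
      set_bij M Mt proj,
      compact Mt /\ hausdorff_null d [set r | Mt r /\ ~ Mt_smooth_at r],
      proj @` Uunique `<=` Mt
    & forall p r, M p -> proj p = r ->
        [/\ hatq s r = hatq s p, hatH s r = hatH s p,
            forall x, x \in hatH s p -> gstar s r x = gstar s p x
          & proj r = r]].

Definition local_param (N : set 'rV[R]_D) p y0 (psi : 'rV[R]_D -> 'rV[R]_D) :
    Prop :=
  let chart y := orthproj [set` hatH s p] (y - hatq s p) in
  [/\ psi 0 = y0,
      forall x, x \in hatH s p -> enorm x < c1 P * h ->
        N (psi x) /\ chart (psi x) = x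
    & exists2 e : R, 0 < e &
        forall y, N y -> eball y0 e y -> psi (chart y) = y].

(* Differentiability at x of a map defined on H(p). *)
Definition diff_on p x (psi : 'rV[R]_D -> 'rV[R]_D) : Prop :=
  differentiable (psi \o orthproj [set` hatH s p]) x.

(* Statements that mention D phit are required only at the points where Mt is
   a manifold; `|_| is the sup norm. *)
Definition constants_ok : Prop :=
  [/\ forall p, M p -> enorm (proj p - p) <= cMMLS P * sqrtD * h ^+ m.+1,
      forall p, M p -> local_param M p p (phi s p) /\
        forall x, x \in hatH s p -> enorm x < c1 P * h ->
          diff_on p x (phi s p) /\
          forall v, v \in hatH s p -> enorm v = 1 ->
            `| 'D_v (gstar s p) x - 'D_v (phi s p) x | <= cM P * h ^+ m
    & forall p, M p -> Mt_smooth_at (proj p) ->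
        local_param Mt p (proj p) (phit s p) /\
        forall x, x \in hatH s p -> enorm x < c1 P * h ->
          Mt_smooth_at (phit s p x) ->
          diff_on p x (phit s p) /\
          forall v, v \in hatH s p -> enorm v = 1 ->
            `| 'D_v (gstar s p) x - 'D_v (phit s p) x | <= cMt P * h ^+ m].

Definition Tt r : set 'rV[R]_D :=
  [set w | exists2 u, u \in hatH s r & w = 'D_u (gstar s r) 0].

Definition retr r xi : 'rV[R]_D := proj (r + xi).

Definition domain_ok : Prop :=
  exists Qr : 'rV[R]_D -> R,
    [/\ forall r, Mt r -> 0 < Qr r /\
          forall xi, Tt r xi -> enorm xi <= Qr r -> Uunique (r + xi),
        radQ s = inf [set Qr r | r in Mt]
      & 0 < radQ s].

Definition setK : set ('rV[R]_D * 'rV[R]_D) :=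
  [set rx | [/\ Mt rx.1, Tt rx.1 rx.2 & enorm rx.2 <= radQ s]].

(* Statements that mention the tangent space of Mt at r are required only
   where Mt is a manifold. *)
Definition retraction_ok : Prop :=
  [/\ compact setK, 0 < boundLv s, 0 < Ltilde s &
      forall r xi, setK (r, xi) ->
      let v' := derive1 (vcorr s r xi) 0 in
      [/\ (exists2 e : R, 0 < e &
             forall k, class_C k [set t : R | `|t| < e] (vcorr s r xi)),
          (\forall t \near (0 : R),
             forall u, u \in hatH s (r + t *: xi) -> dot (vcorr s r xi t) u = 0),
          is_derive (0 : R) 1 (fun t => retr r (t *: xi)) (xi + v'),
          enorm v' <= boundLv s
        & Mt_smooth_at r ->
          [/\ \forall t \near (0 : R),
                tangent_space Mt r (t *: xi + vcorr s r xi t),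
              tangent_space Mt r (xi + v')
            & `| f (retr r xi) - (f r + dot (rgrad Mt f r) (xi + v')) |
                <= Ltilde s / 2 * enorm xi ^+ 2]]].

Definition cost_ok : Prop :=
  let C := convex_hull (Mt `|` M) in
  [/\ forall x, C x -> differentiable f x,
      forall x y, C x -> C y ->
        enorm (egrad f y - egrad f x) <= lipL P * enorm (y - x),
      forall x, M x \/ Mt x -> fstar P <= f x
    & forall r, Mt r -> enorm (egrad f r) <= boundG P].

Definition setting_ok : Prop :=
  [/\ quasi_uniform, weights_ok & mmls_ok] /\
  [/\ known_facts, constants_ok, domain_ok, retraction_ok & cost_ok].

Definition agrad x : 'rV[R]_D := orthproj (Tt x) (egrad f x).

Definition alphahat x : R := Num.min (alphabar P) (radQ s / enorm (agrad x)).

Definition bt_continue x (a : R) : Prop :=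
  f x - f (retr x (- (a *: agrad x))) < delta P * a * enorm (agrad x) ^+ 2.

(* The backtracking loop at x stops after exactly k reductions; it has then
   used k+1 retractions and evaluations of f, f x and agrad x being known. *)
Definition bt_stops x (k : nat) : Prop :=
  ~ bt_continue x (alphahat x * gamma P ^+ k) /\
  forall j, (j < k)%N -> bt_continue x (alphahat x * gamma P ^+ j).

Definition stepsize x : R := alphahat x * gamma P ^+ xget 0%N (bt_stops x).

Definition iterate x0 (i : nat) : 'rV[R]_D :=
  iter i (fun x => retr x (- (stepsize x *: agrad x))) x0.

Definition threshold x : R :=
  Num.max (6 * boundLv s / alphabar P)
          (2 * cMt P * enorm (egrad f x) * sqrtD * h ^+ m).

Definition eps4 (eps : R) x : R := threshold x + eps.

(* The hypotheses on a run of N iterations from x0: they bear on the points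
   x_0, ..., x_(N-1) from which an iteration is performed, and in any case on
   x_0.  (They cannot hold for infinitely many iterates: each iteration then
   decreases f by a fixed amount.) *)
Definition run_ok x0 (N : nat) : Prop :=
  [/\ Mt x0, 6 * boundLv s <= radQ s &
      forall i, (i < maxn N 1)%N ->
        Mt_smooth_at (iterate x0 i) /\
        threshold (iterate x0 i) <= enorm (agrad (iterate x0 i))].

(* The point returned after N iterations: among x_0, ..., x_N, one with the
   smallest approximate gradient. *)
Definition output x0 (N : nat) : 'rV[R]_D :=
  iterate x0 [arg min_(i < (ord0 : 'I_N.+1)) enorm (agrad (iterate x0 i))]%O.

Definition bound_b (eps : R) x : R :=
  (cM P * boundG P + cMMLS P) * sqrtD * h ^+ m + eps4 eps x.

Definition bound_a_holds (eps : R) x : Prop := enorm (agrad x) <= eps4 eps x.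

Definition bound_b_holds (eps : R) x : Prop :=
  enorm (egrad f x) <= boundG P /\
  forall p, M p -> proj p = x ->
    enorm (rgrad M f p) <= bound_b eps x /\
    enorm (p - x) <= cMMLS P * sqrtD * h ^+ m.+1.

Definition stepmin : R :=
  Num.min (alphabar P) (2 * gamma P * (4^-1 - delta P) / Ltilde s).

Definition max_iterations x0 (e : R) : int :=
  if radQ s / stepmin < e
  then Num.ceil ((f x0 - fstar P) / (radQ s * delta P) * e^-1)
  else Num.ceil ((f x0 - fstar P) / (delta P * stepmin) * (e ^+ 2)^-1).

Definition beta x : R :=
  1 - cMt P * enorm (egrad f x) * sqrtD * h ^+ m / enorm (agrad x).

Definition max_evals x : R :=
  Num.max 1 (2 + ln (alphahat x * Ltilde s /
                     (2 * gamma P * (beta x / 2 - delta P))) / ln (gamma P)^-1).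

End MMLS.

(* Main.v *)
Require Import Defs.
From HB Require Import structures.
From mathcomp Require Import all_boot all_order all_algebra.
From mathcomp Require Import all_classical all_reals all_analysis.
From mathcomp Require Import ring lra.
Set Implicit Arguments.
Unset Strict Implicit.
Unset Printing Implicit Defensive.
Import Order.TTheory GRing.Theory Num.Theory.
Import numFieldNormedType.Exports.
Local Open Scope classical_set_scope.
Local Open Scope ring_scope.

(** The approximate gradient is an honest descent direction as long as it
    dominates the errors of the construction.  Write [g] for the Euclidean
    gradient at a point [r] of [Mt], [ag] for its projection onto the
    approximate tangent space [Tt r], and [h] for the fill distance.

    Geometry.  The local parametrizations realize the tangent spaces of [Mt]
    and of [M] as linear images of [hatH]: every curve in the set is, near its
    base point, the image of its own chart coordinates
    ([tangent_space_linear], [chart_of_tangent]).  The constants [cMt] and [cM]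
    compare these linear maps with the derivative of the fitted polynomial,
    whose image is [Tt r]; so each tangent vector [w] is within
    [C * sqrt D * |w|] of [Tt r], and since [g - ag] is orthogonal to [Tt r],
    the pairing of [g - ag] with [w] is at most [C * |g| * sqrt D * |w|]
    ([normal_part_small]).  Applied on [M] with [w] the Riemannian gradient,
    this gives the bound on [rgrad M f p] in terms of [ag] ([rgrad_le]).

    Descent.  The velocity of the approximate retraction along [xi] is
    [xi + v'], where [v'] depends homogeneously on [xi]; hence the bound
    [boundLv] on the ball of radius [radQ] shrinks to [|v'| <= |xi| / 6] as
    soon as [6 * boundLv <= radQ] ([vcorr_le]).  With [xi = - a ag] and
    [k = 1 - beta <= 1/2], the two perturbations leave
    [- <g, xi + v'> >= (1 - 1/6 - 7/6 k) a |ag|^2 >= (beta / 2) a |ag|^2];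
    the last inequality is an equality at [k = 1/2], which is where the
    constants 6 and 2 of the hypotheses come from ([descent_direction]).
    With the quadratic error of the retraction, every step below
    [2 (beta / 2 - delta) / Ltilde] passes the backtracking test
    ([bt_continue_large]), so backtracking ends after logarithmically many
    trials ([bt_stops_evals]) with a step that lowers the cost by at least
    [delta * min (stepmin |ag|^2) (radQ |ag|)] ([next_decrease]).

    Counting.  If the smallest approximate gradient of the run exceeds [e],
    each of the [N] iterations lowers the cost by a fixed amount, while the
    total decrease is at most [f x0 - fstar] ([run_length_lt]); both iteration bounds are the
    two values of the minimum above ([max_iterationsE]).  Since [|g|] is
    bounded by [boundG] uniformly in [h], the thresholds vanish with [h] and
    [boundLv] ([threshold_le]). *)

(** * Euclidean geometry of row vectors *)

Section Euclidean_geometry.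
Context {R : realType} {D : nat}.
Implicit Types (x y u v w : 'rV[R]_D) (V : {vspace 'rV[R]_D}).

Lemma dotE u v : dot u v = \sum_i u 0 i * v 0 i.
Proof. by rewrite /dot mxE; apply: eq_bigr => i _; rewrite mxE. Qed.

Lemma dotC u v : dot u v = dot v u.
Proof. by rewrite !dotE; apply: eq_bigr => i _; rewrite mulrC. Qed.

Lemma dotDl u v w : dot (u + v) w = dot u w + dot v w.
Proof. by rewrite /dot mulmxDl mxE. Qed.

Lemma dotZl (a : R) u v : dot (a *: u) v = a * dot u v.
Proof. by rewrite /dot -scalemxAl mxE. Qed.

Lemma dotNl u v : dot (- u) v = - dot u v.
Proof. by rewrite -scaleN1r dotZl mulN1r. Qed.

Lemma dotBl u v w : dot (u - v) w = dot u w - dot v w.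
Proof. by rewrite dotDl dotNl. Qed.

Lemma dotDr u v w : dot w (u + v) = dot w u + dot w v.
Proof. by rewrite dotC dotDl !(dotC w). Qed.

Lemma dotZr (a : R) u v : dot u (a *: v) = a * dot u v.
Proof. by rewrite dotC dotZl dotC. Qed.

Lemma dotNr u v : dot u (- v) = - dot u v.
Proof. by rewrite dotC dotNl dotC. Qed.

Lemma dotBr u v w : dot w (u - v) = dot w u - dot w v.
Proof. by rewrite dotDr dotNr. Qed.

Lemma dot_ge0 u : 0 <= dot u u.
Proof. by rewrite dotE sumr_ge0 // => i _; rewrite -expr2 sqr_ge0. Qed.

Lemma dot_eq0 u : dot u u = 0 -> u = 0.
Proof.
rewrite dotE => /eqP; rewrite psumr_eq0; last first.
  by move=> i _; rewrite -expr2 sqr_ge0.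
move=> /allP u0; apply/rowP => i; rewrite mxE; apply/eqP.
by have := u0 i (mem_index_enum i); rewrite mulf_eq0 orbb.
Qed.

Lemma enorm_ge0 u : 0 <= enorm u.
Proof. exact: sqrtr_ge0. Qed.

Lemma enorm_sqr u : enorm u ^+ 2 = dot u u.
Proof. by rewrite sqr_sqrtr // dot_ge0. Qed.

Lemma enorm0 : enorm (0 : 'rV[R]_D) = 0.
Proof. by rewrite /enorm /dot mul0mx mxE sqrtr0. Qed.

Lemma enorm_eq0 u : enorm u = 0 -> u = 0.
Proof. by move=> u0; apply: dot_eq0; rewrite -enorm_sqr u0 expr0n. Qed.

Lemma enormZ (a : R) u : enorm (a *: u) = `|a| * enorm u.
Proof.
by rewrite /enorm dotZl dotZr mulrA -expr2 sqrtrM ?sqr_ge0 // sqrtr_sqr.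
Qed.

Lemma enormN u : enorm (- u) = enorm u.
Proof. by rewrite -scaleN1r enormZ normrN1 mul1r. Qed.

Lemma cauchy_schwarz u v : dot u v <= enorm u * enorm v.
Proof.
have [-> | v0] := eqVneq v 0.
  by rewrite enorm0 mulr0 dotC /dot mul0mx mxE.
have nv : 0 < enorm v.
  rewrite lt_neqAle enorm_ge0 andbT eq_sym.
  by apply: contra_neq v0; exact: enorm_eq0.
set w := enorm v *: u - (dot u v / enorm v) *: v.
have ww : dot w w = (enorm u * enorm v) ^+ 2 - dot u v ^+ 2.
  rewrite /w !(dotBl, dotBr, dotZl, dotZr) (dotC v u) -!enorm_sqr.
  by field; rewrite gt_eqF.
have := dot_ge0 w; rewrite ww.
rewrite subr_ge0 => le2; apply: le_trans (ler_norm _) _.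
by rewrite -ler_sqr ?nnegrE ?mulr_ge0 ?enorm_ge0 // real_normK ?num_real.
Qed.

Lemma enormD u v : enorm (u + v) <= enorm u + enorm v.
Proof.
rewrite -ler_sqr ?nnegrE ?addr_ge0 ?enorm_ge0 // enorm_sqr.
rewrite !(dotDl, dotDr) -!enorm_sqr (dotC v u).
by have := cauchy_schwarz u v; lra.
Qed.

Lemma enormB_sym u v : enorm (u - v) = enorm (v - u).
Proof. by rewrite -enormN opprB. Qed.

(** Turns the sup-norm estimates on the parametrizations into Euclidean ones;
    the source of the factors [sqrt D] next to [cM] and [cMt]. *)
Lemma enorm_le_sup u : enorm u <= Num.sqrt D%:R * `|u|.
Proof.
rewrite -ler_sqr ?nnegrE ?mulr_ge0 ?sqrtr_ge0 ?enorm_ge0 //.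
rewrite enorm_sqr exprMn sqr_sqrtr ?ler0n // dotE mulr_natl.
have -> : `|u| ^+ 2 *+ D = \sum_(i < D) `|u| ^+ 2.
  by rewrite sumr_const card_ord.
apply: ler_sum => i _; rewrite -expr2 -real_normK ?num_real //.
rewrite ler_sqr ?nnegrE //.
rewrite [X in _ <= X](_ : _ = mx_norm u) // mx_normrE.
exact: (le_bigmax _ (fun ij : 'I_1 * 'I_D => `|u ij.1 ij.2|) (0, i)).
Qed.

(** Gram-Schmidt: one more spanning vector only requires correcting along its
    component orthogonal to the previous ones. *)
Lemma orth_decomp V x :
  exists2 y, y \in V & forall z, z \in V -> dot (x - y) z = 0.
Proof.
rewrite -(span_basis (vbasisP V)); elim: (tval (vbasis V)) x => [|v X IH] x.
  exists 0; first by rewrite mem0v.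
  by move=> z; rewrite span_nil memv0 => /eqP ->; rewrite dotC /dot mul0mx mxE.
have [v1 v1s v1o] := IH v; have [y ys yo] := IH x.
rewrite span_cons; move: v1o (subrK v1 v); move: (v - v1) => w v1o vE.
have wV : w \in (<[v]> + <<X>>)%VS.
  have -> : w = v - v1 by rewrite -vE addrK.
  by rewrite memv_add ?memv_line // rpredN.
exists (y + (dot x w / dot w w) *: w).
  by rewrite rpredD ?rpredZ // (subvP (addvSr _ _)).
have o1 z : z \in <<X>>%VS -> dot (x - (y + (dot x w / dot w w) *: w)) z = 0.
  by move=> zs; rewrite opprD addrA dotBl yo // dotZl (v1o z) // mulr0 subrr.
have o2 : dot (x - (y + (dot x w / dot w w) *: w)) w = 0.
  have yw : dot y w = 0 by rewrite dotC v1o.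
  rewrite opprD addrA !dotBl yw dotZl subr0.
  have [w0|w0] := eqVneq (dot w w) 0.
    by rewrite w0 invr0 !mulr0 subr0 (dot_eq0 w0) dotC /dot mul0mx mxE.
  by rewrite divfK // subrr.
move=> z /memv_addP[_ /vlineP[k ->] [z2 z2s ->]].
have -> : k *: v + z2 = k *: w + (k *: v1 + z2).
  by rewrite addrA -scalerDr vE.
by rewrite dotDr dotZr o2 mulr0 o1 ?addr0 // rpredD ?rpredZ.
Qed.

Lemma orthprojP V x :
  orthproj [set` V] x \in V /\
  forall z, z \in V -> dot (x - orthproj [set` V] x) z = 0.
Proof.
have [y yV yo] := orth_decomp V x.
by have [] := @xgetPex _ 0 [set y | [set` V] y /\
  forall z, [set` V] z -> dot (x - y) z = 0] (ex_intro _ y (conj yV yo)).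
Qed.

Lemma orthproj_mem V x : orthproj [set` V] x \in V.
Proof. by have [] := orthprojP V x. Qed.

Lemma dot_orthproj V x z : z \in V -> dot (orthproj [set` V] x) z = dot x z.
Proof.
move=> zV; have [_ /(_ z zV)] := orthprojP V x.
by rewrite dotBl => /eqP; rewrite subr_eq0 => /eqP.
Qed.

Lemma orthproj_unique V x y :
  y \in V -> (forall z, z \in V -> dot y z = dot x z) ->
  orthproj [set` V] x = y.
Proof.
move=> yV yx; apply/eqP; rewrite -subr_eq0; apply/eqP/dot_eq0.
have dV : orthproj [set` V] x - y \in V by rewrite rpredB ?orthproj_mem.
by rewrite dotBl dot_orthproj // yx // subrr.
Qed.

Lemma orthproj_id V x : x \in V -> orthproj [set` V] x = x.
Proof. by move=> xV; apply: orthproj_unique. Qed.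

Lemma orthprojZ V (a : R) x :
  orthproj [set` V] (a *: x) = a *: orthproj [set` V] x.
Proof.
apply: orthproj_unique => [|z zV]; first by rewrite rpredZ ?orthproj_mem.
by rewrite !dotZl dot_orthproj.
Qed.

Lemma orthprojB V x y :
  orthproj [set` V] (x - y) = orthproj [set` V] x - orthproj [set` V] y.
Proof.
apply: orthproj_unique => [|z zV]; first by rewrite rpredB ?orthproj_mem.
by rewrite !dotBl !dot_orthproj.
Qed.

Lemma enorm_orthproj V x : enorm (orthproj [set` V] x) <= enorm x.
Proof.
have [->|p0] := eqVneq (enorm (orthproj [set` V] x)) 0.
  exact: enorm_ge0.
have pp : 0 < enorm (orthproj [set` V] x) by rewrite lt_neqAle eq_sym p0 enorm_ge0.
rewrite -(ler_pM2r pp) -expr2 enorm_sqr dot_orthproj ?orthproj_mem //.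
exact: cauchy_schwarz.
Qed.

Lemma enorm_orthprojC V x : enorm (x - orthproj [set` V] x) <= enorm x.
Proof.
rewrite -ler_sqr ?nnegrE ?enorm_ge0 // !enorm_sqr.
have e : dot (x - orthproj [set` V] x) (orthproj [set` V] x) = 0.
  by have [pV ->] := orthprojP V x.
by move: (dot_ge0 (orthproj [set` V] x)) e; rewrite !(dotBl, dotBr) (dotC _ x); lra.
Qed.

End Euclidean_geometry.

(** * Directional derivatives and polynomial maps *)

Section Calculus.
Context {R : realType}.

(** Directional derivatives only see a line.  This is what makes derivatives
    along [hatH] insensitive to the values of the maps off that subspace. *)
Lemma eq_derive_line {V W : normedModType R} (f g : V -> W) x y v w :
  (forall t : R, f (x + t *: v) = g (y + t *: w)) -> 'D_v f x = 'D_w g y.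
Proof.
move=> fg; have fgx : f x = g y by have := fg 0; rewrite !scale0r !addr0.
have e : (fun t : R => t^-1 *: ((f \o shift x) (t *: v) - f x)) =
         (fun t : R => t^-1 *: ((g \o shift y) (t *: w) - g y)).
  by apply: funext => t /=; rewrite fgx [_ + x]addrC [_ + y]addrC fg.
by rewrite /derive e.
Qed.

Lemma is_derive_line {V W : normedModType R} (g : V -> W) x v :
  differentiable g x ->
  is_derive (0 : R) 1 (fun t : R => g (x + t *: v)) ('D_v g x).
Proof.
move=> dg; have gv : derivable g x v by exact: diff_derivable.
have e : (fun t : R => t^-1 *: (((fun t : R => g (x + t *: v)) \o shift 0) (t *: 1)
           - g (x + 0 *: v))) = (fun t => t^-1 *: ((g \o shift x) (t *: v) - g x)).
  apply: funext => t /=.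
  by rewrite addr0 scale0r addr0 [x + _]addrC [t *: 1]mulr1.
split; first by rewrite /derivable e.
by rewrite /derive e.
Qed.

Lemma differentiable_prod {V : normedModType R} (I : Type) (X : seq I)
    (F : I -> V -> R) x :
  (forall i, differentiable (F i) x) ->
  differentiable (fun y => \prod_(i <- X) F i y) x.
Proof.
move=> dF; elim: X => [|i X IH].
  by under eq_fun do rewrite big_nil; exact: differentiable_cst.
by under eq_fun do rewrite big_cons; exact: differentiableM.
Qed.

Lemma differentiable_bigsum {V W : normedModType R} (I : Type) (X : seq I)
    (p : pred I) (F : I -> V -> W) x :
  (forall i, differentiable (F i) x) ->
  differentiable (fun y => \sum_(i <- X | p i) F i y) x.
Proof.
move=> dF; elim: X => [|i X IH].
  by under eq_fun do rewrite big_nil; exact: differentiable_cst.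
under eq_fun do rewrite big_cons; case: (p i) => //.
exact: differentiableD.
Qed.

Lemma poly_map_differentiable {D : nat} m (G : 'rV[R]_D -> 'rV[R]_D) x :
  poly_map m G -> differentiable G x.
Proof.
case=> c Gc; rewrite (funext Gc).
apply: differentiable_bigsum => a; apply: differentiableZl.
apply: differentiable_prod => k.
elim: (a k : nat) => [|n IH].
  by under eq_fun do rewrite expr0; exact: differentiable_cst.
under eq_fun do rewrite exprS; apply: differentiableM => //.
exact: differentiable_coord.
Qed.

End Calculus.

(** * Tangent spaces seen through a local parametrization *)

Section Charts.
Context {R : realType} {D : nat} (P : problem R D) (s : sampling R D).
Variables (N : set 'rV[R]_D) (p y0 : 'rV[R]_D) (psi : 'rV[R]_D -> 'rV[R]_D).
Hypothesis ch_pos : 0 < c1 P * fillh s.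
Hypothesis psiP : local_param P s N p y0 psi.
Hypothesis psi_diff : diff_on s p 0 psi.

Local Notation H := (hatH s p).
Local Notation proj_H := (orthproj [set` H]).

Lemma derive_chart v : v \in H -> 'D_v psi 0 = 'd (psi \o proj_H) 0 v.
Proof.
move=> vH; rewrite -deriveE //; apply: eq_derive_line => t /=.
by rewrite add0r orthproj_id // rpredZ.
Qed.

(** The image under [psi] of a line of [hatH] through 0 stays in [N] for a
    short time, as [psi] is a parametrization on a whole ball. *)
Lemma tangent_of_chart v : v \in H -> tangent_space N y0 ('D_v psi 0).
Proof.
case: psiP => psi0 psiN _ vH; exists (fun t => (psi \o proj_H) (0 + t *: v)); split.
- have [-> | v0] := eqVneq v 0.
    near=> t; rewrite scaler0 addr0 /= orthproj_id ?mem0v //.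
    by have [] := psiN 0 (mem0v _); rewrite ?enorm0.
  have nv : 0 < enorm v.
    by rewrite lt_neqAle enorm_ge0 andbT eq_sym; apply: contra_neq v0; exact: enorm_eq0.
  near=> t; rewrite add0r /= orthproj_id ?rpredZ //.
  have [] // := psiN (t *: v); first by rewrite rpredZ.
  rewrite enormZ -ltr_pdivlMr //.
  near: t; apply: (@nbhs0_lt R R^o); exact: divr_gt0.
- by rewrite scale0r addr0 /= orthproj_id ?mem0v.
- rewrite (_ : 'D_v psi 0 = 'D_v (psi \o proj_H) 0).
    exact: is_derive_line.
  by rewrite derive_chart // deriveE.
Unshelve. all: by end_near. Qed.

(** Near its base point a curve [c] in [N] satisfies
    [c t = psi (proj_H (c t - y0))], because [proj_H (y0 - hatq s p) = 0]; the
    chain rule at 0 then recovers the velocity from its own projection. *)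
Lemma chart_of_tangent w : tangent_space N y0 w -> w = 'D_(proj_H w) psi 0.
Proof.
case: psiP => psi0 psiN [e e0 psiK] [c [cN c0 dc]].
have y0q : proj_H (y0 - hatq s p) = 0.
  by rewrite -psi0; have [] := psiN 0 (mem0v _); rewrite ?enorm0.
rewrite derive_chart ?orthproj_mem //.
have dcd : differentiable c 0 by apply/derivable1_diffP; apply: ex_derive.
have cc : {for 0, continuous c} by exact: differentiable_continuous.
have near_c : \forall t \near (0 : R), c t = (psi \o proj_H) (c t - y0).
  near=> t.
  have cty : enorm (c t - y0) < e.
    apply: le_lt_trans (enorm_le_sup _) _.
    have ? : 0 < Num.sqrt D%:R + 1 :> R by rewrite ltr_wpDl ?sqrtr_ge0.
    apply: (@le_lt_trans _ _ ((Num.sqrt D%:R + 1) * `|c t - y0|)).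
      by rewrite ler_wpM2r // lerDl.
    rewrite mulrC -ltr_pdivlMr // -c0 distrC.
    near: t; move/cvgrPdist_lt : cc; apply; exact: divr_gt0.
  have Nct : N (c t) by near: t.
  rewrite -{1}(psiK _ Nct cty) /=; congr psi.
  have -> : c t - y0 = (c t - hatq s p) - (y0 - hatq s p).
    by rewrite opprB addrA subrK.
  by rewrite [RHS]orthprojB y0q subr0.
pose k (t : R) : 'rV[R]_D := c t - y0.
have k0 : k 0 = 0 by rewrite /k c0 subrr.
have dkw : is_derive (0 : R) 1 k w.
  by rewrite -[w]subr0; apply: is_deriveB.
have dk : differentiable k 0 by apply/derivable1_diffP; apply: ex_derive.
have kw : 'd k 0 1 = w by rewrite -deriveE //; apply: derive_val.
have dPk : differentiable (psi \o proj_H) (k 0) by rewrite k0.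
have cw : 'D_1 c 0 = w by apply: derive_val.
have -> : 'd (psi \o proj_H) 0 (proj_H w) = 'd (psi \o proj_H) 0 w.
  transitivity ('D_(proj_H w) (psi \o proj_H) 0); first by rewrite deriveE.
  transitivity ('D_w (psi \o proj_H) 0); last by rewrite deriveE.
  apply: eq_derive_line => t /=.
  by rewrite !add0r !orthprojZ (orthproj_id (orthproj_mem _ w)).
have dcomp : differentiable ((psi \o proj_H) \o k) 0 by exact: differentiable_comp.
have := @near_eq_derive R R _ c ((psi \o proj_H) \o k) 0 1 near_c.
by rewrite cw (deriveE _ dcomp) diff_comp //= k0 kw.
Unshelve. all: by end_near. Qed.

(** Velocities of curves form a linear space here, so that the orthogonal
    projection onto them exists and [rgrad] is not its default value 0; the
    local parametrization does the work of the implicit function theorem. *)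
Lemma tangent_space_linear :
  exists V : {vspace 'rV[R]_D}, tangent_space N y0 = [set` V].
Proof.
exists (linfun ('d (psi \o proj_H) 0) @: H)%VS; apply/seteqP; split=> w /=.
  move=> /chart_of_tangent ->; rewrite derive_chart ?orthproj_mem //.
  by apply/memv_imgP; exists (proj_H w); rewrite ?orthproj_mem ?lfunE.
case/memv_imgP => v vH ->; rewrite lfunE /= -derive_chart //.
exact: tangent_of_chart.
Qed.

End Charts.

(** * Approximate and exact tangent spaces *)

Section Geometry.
Context {R : realType} {D : nat} (P : problem R D) (s : sampling R D).
Hypothesis HP : problem_ok P.
Hypothesis HS : setting_ok P s.
Implicit Types (p q r x y xi v w : 'rV[R]_D).

Local Notation M := (mfd P).
Local Notation f := (cost P).
Local Notation h := (fillh s).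
Local Notation m := (deg P).
Local Notation sqrtD := (Num.sqrt (D%:R : R)).
Local Notation Mt := (Mt P s).
Local Notation Tt := (Tt s).
Local Notation agrad := (agrad P s).
Local Notation retr := (retr s).
Local Notation proj := (Defs.proj s).
Local Notation Mt_smooth_at := (Mt_smooth_at P s).

Lemma fillh_gt0 : 0 < h.
Proof. by case: HS => [[[]]]. Qed.

Lemma chart_radius_gt0 : 0 < c1 P * h.
Proof.
case: HP => _ [[_ c13 _ _ _] _]; apply: mulr_gt0 fillh_gt0.
exact: lt_trans c13.
Qed.

Lemma radQ_gt0 : 0 < radQ s.
Proof. by case: HS => _ [_ _ [Qr []]]. Qed.

Lemma zero_Tt r : Tt r 0.
Proof. by exists 0; rewrite ?mem0v ?derive0. Qed.

Lemma Tt_Uunique r xi : Mt r -> Tt r xi -> enorm xi <= radQ s ->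
  Uunique P s (r + xi).
Proof.
case: HS => _ [_ _ [Qr [QrP QE Q0]] _ _] rMt xiT xiQ.
have [_ H] := QrP r rMt; apply: H => //; apply: le_trans xiQ _.
rewrite QE; apply: ge_inf; last by exists r.
by exists 0 => _ [t tMt <-]; have [/ltW] := QrP t tMt.
Qed.

Lemma retr_Mt r xi : Mt r -> Tt r xi -> enorm xi <= radQ s -> Mt (retr r xi).
Proof.
move=> rMt xiT xiQ; have U := Tt_Uunique rMt xiT xiQ.
by case: HS => _ [[_ _ _ H _] _ _ _ _]; apply: H; exists (r + xi).
Qed.

(** [gstar s r] is prescribed on [hatH s r] only, where it agrees with a
    polynomial map; its derivatives along that subspace are therefore linear. *)
Lemma gstar_linear r : Mt r ->
  exists l : {linear 'rV[R]_D -> 'rV[R]_D},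
    forall v, v \in hatH s r -> 'D_v (gstar s r) 0 = l v.
Proof.
move=> rMt.
have rU : Uunique P s r.
  rewrite -[r]addr0; apply: Tt_Uunique => //; first exact: zero_Tt.
  by rewrite enorm0 ltW ?radQ_gt0.
case: HS => [[_ _ [_ /(_ r rU) [_ [[G Gm gG] _]]]] _].
exists ('d G 0) => v vH; rewrite -deriveE; last exact: poly_map_differentiable Gm.
by apply: eq_derive_line => t; rewrite gG // add0r rpredZ.
Qed.

Lemma Tt_linear r : Mt r ->
  exists V : {vspace 'rV[R]_D}, Tt r = [set` V].
Proof.
move=> rMt; have [l lP] := gstar_linear rMt.
exists (linfun l @: hatH s r)%VS; apply/seteqP; split=> w /=.
  move=> [u uH ->]; apply/memv_imgP.
  by exists u => //; rewrite lfunE lP.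
by case/memv_imgP => u uH ->; exists u; rewrite // lfunE lP.
Qed.

Lemma TtZ r (a : R) xi : Mt r -> Tt r xi -> Tt r (a *: xi).
Proof.
by move=> /Tt_linear[V ->] /= xiV; rewrite rpredZ.
Qed.

Lemma agrad_Tt r : Mt r -> Tt r (agrad r).
Proof. by rewrite /Defs.agrad => /Tt_linear[V ->]; exact: orthproj_mem. Qed.

Lemma dot_agrad r z : Mt r -> Tt r z -> dot (egrad f r - agrad r) z = 0.
Proof.
rewrite /Defs.agrad => /Tt_linear[V ->] zV.
by have [_] := orthprojP V (egrad f r); apply.
Qed.

Lemma enorm_agradC r : Mt r -> enorm (egrad f r - agrad r) <= enorm (egrad f r).
Proof. by rewrite /Defs.agrad => /Tt_linear[V ->]; exact: enorm_orthprojC. Qed.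

Section Tangent_comparison.
Variables (N : set 'rV[R]_D) (p y0 r : 'rV[R]_D) (psi : 'rV[R]_D -> 'rV[R]_D).
Variable (C : R).
Hypotheses (pM : M p) (pr : proj p = r) (C0 : 0 <= C).
Hypothesis psiP : local_param P s N p y0 psi.
Hypothesis psi_diff : diff_on s p 0 psi.
Hypothesis psiC : forall v, v \in hatH s p -> enorm v = 1 ->
  `| 'D_v (gstar s p) 0 - 'D_v psi 0 | <= C.

(** With [w = D psi [v]] and [v] the projection of [w] onto [hatH s p], the
    vector [D gstar [v]] is close to [w] by hypothesis, and [|v| <= |w|]. *)
Lemma tangent_near_Tt w : tangent_space N y0 w ->
  exists2 z, Tt r z & enorm (w - z) <= sqrtD * C * enorm w.
Proof.
move=> wT; have rMt : Mt r by exists p.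
have wE := chart_of_tangent chart_radius_gt0 psiP psi_diff wT.
have dE := derive_chart psi_diff.
case: HS => _ [[_ _ _ _ /(_ p r pM pr) [_ Hrp gE _]] _ _ _ _].
have [l lP] := gstar_linear rMt.
have lPp u : u \in hatH s p -> 'D_u (gstar s p) 0 = l u.
  move=> uH; rewrite -lP ?Hrp //; apply: eq_derive_line => t.
  by rewrite gE // add0r rpredZ.
have vH := orthproj_mem (hatH s p) w.
set v := orthproj _ w in wE vH.
have vw : enorm v <= enorm w by exact: enorm_orthproj.
(* The hypothesis bounds derivatives along unit vectors, hence the rescaling
   of [v] below. *)
exists (l v); first by exists v; rewrite ?Hrp ?lP ?Hrp.
have [v0|v0] := eqVneq (enorm v) 0.
  rewrite wE (enorm_eq0 v0) derive0 linear0 subr0 enorm0 mulr0.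
  by [].
have nv : 0 < enorm v by rewrite lt_neqAle eq_sym v0 enorm_ge0.
set u := (enorm v)^-1 *: v.
have uH : u \in hatH s p by rewrite rpredZ.
have u1 : enorm u = 1.
  by rewrite enormZ gtr0_norm ?invr_gt0 // mulVf.
have vu : v = enorm v *: u by rewrite scalerA divff // scale1r.
have -> : w - l v = enorm v *: ('D_u psi 0 - 'D_u (gstar s p) 0).
  rewrite {1}wE (dE _ vH) (dE _ uH) lPp // scalerBr.
  by congr (_ - _); rewrite {1}vu linearZ.
rewrite enormZ gtr0_norm //.
apply: (@le_trans _ _ (enorm v * (sqrtD * C))).
  rewrite ler_wpM2l ?enorm_ge0 //; apply: le_trans (enorm_le_sup _) _.
  by rewrite ler_wpM2l ?sqrtr_ge0 // distrC psiC.
by rewrite mulrC ler_wpM2l // mulr_ge0 ?sqrtr_ge0.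
Qed.

(** Subtracting from [w] its neighbour in [Tt r] changes nothing, since the
    residual [egrad f r - agrad r] is orthogonal to [Tt r]. *)
Lemma normal_part_small w : tangent_space N y0 w ->
  dot (egrad f r - agrad r) w <= C * enorm (egrad f r) * sqrtD * enorm w.
Proof.
move=> wT; have rMt : Mt r by exists p.
have [z zT wz] := tangent_near_Tt wT.
have -> : dot (egrad f r - agrad r) w = dot (egrad f r - agrad r) (w - z).
  by rewrite dotBr (dot_agrad rMt zT) subr0.
apply: le_trans (cauchy_schwarz _ _) _.
apply: (@le_trans _ _ (enorm (egrad f r) * (sqrtD * C * enorm w))).
  by apply: ler_pM => //; rewrite ?enorm_ge0 // enorm_agradC.
by rewrite le_eqVlt; apply/orP; left; apply/eqP; ring.
Qed.

End Tangent_comparison.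

Lemma sub_convex_hull (A : set 'rV[R]_D) x : A x -> convex_hull A x.
Proof.
move=> Ax; exists 1%N, (fun=> 1), (fun=> x); split=> //.
  by rewrite big_ord1.
by rewrite big_ord1 scale1r.
Qed.

(** Test the gradient at [p] against [y = rgrad M f p] itself, so that
    [|y|^2 = <egrad f p, y>], and split
    [egrad f p = (egrad f p - egrad f r) + (egrad f r - agrad r) + agrad r]:
    the first term is small by the Lipschitz bound and [h * lipL <= 1], the
    second because [y] is nearly in [Tt r]. *)
Lemma rgrad_le p r : M p -> proj p = r ->
  enorm (rgrad M f p) <=
    (cM P * boundG P + cMMLS P) * sqrtD * h ^+ m + enorm (agrad r).
Proof.
move=> pM pr; have rMt : Mt r by exists p.
case: HS => _ [[hL _ _ _ _] [prox phiP _] _ _ [_ lip _ gG]].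
have [lp /(_ 0 (mem0v _))] := phiP p pM.
rewrite enorm0 => /(_ chart_radius_gt0) [dphi Cphi].
have [V VE] := tangent_space_linear chart_radius_gt0 lp dphi.
case: HP => _ [[L0 _ _ _ _] [[cMM0 cM0 _] _]].
have h0 := fillh_gt0.
set y := rgrad M f p.
have yT : tangent_space M p y by rewrite /y /rgrad VE; exact: orthproj_mem.
have yy : enorm y ^+ 2 = dot (egrad f p) y.
  rewrite enorm_sqr {1}/y /rgrad VE dot_orthproj //.
  by move: yT; rewrite VE.
have hm : 0 <= h ^+ m by rewrite exprn_ge0 // ltW.
have [y0|y0] := eqVneq (enorm y) 0.
  rewrite y0 addr_ge0 ?enorm_ge0 // mulr_ge0 // mulr_ge0 ?sqrtr_ge0 //.
  rewrite addr_ge0 // mulr_ge0 //.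
  by apply: le_trans (gG _ rMt); exact: enorm_ge0.
have ny : 0 < enorm y by rewrite lt_neqAle eq_sym y0 enorm_ge0.
rewrite -(ler_pM2r ny) -expr2 yy.
have -> : egrad f p = (egrad f p - egrad f r) + (egrad f r - agrad r) + agrad r.
  by rewrite addrA !subrK.
have e1 : dot (egrad f p - egrad f r) y <= cMMLS P * sqrtD * h ^+ m * enorm y.
  apply: le_trans (cauchy_schwarz _ _) _; rewrite ler_wpM2r ?enorm_ge0 //.
  apply: (@le_trans _ _ (lipL P * enorm (p - r))).
    by apply: lip; apply: sub_convex_hull; [left|right].
  rewrite enormB_sym -pr.
  apply: (@le_trans _ _ (lipL P * (cMMLS P * sqrtD * h ^+ m.+1))).
    by rewrite ler_wpM2l // prox.
  rewrite exprS (_ : _ * _ = (h * lipL P) * (cMMLS P * sqrtD * h ^+ m)); last by ring.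
  by rewrite ler_piMl // !mulr_ge0 ?sqrtr_ge0.
have e2 := normal_part_small pM pr (mulr_ge0 cM0 hm) lp dphi Cphi yT.
have e3 := cauchy_schwarz (agrad r) y.
have e4 : cM P * h ^+ m * enorm (egrad f r) * sqrtD * enorm y <=
          cM P * boundG P * sqrtD * h ^+ m * enorm y.
  rewrite ler_wpM2r ?enorm_ge0 //.
  rewrite (_ : _ * sqrtD * h ^+ m = cM P * h ^+ m * boundG P * sqrtD); last by ring.
  by rewrite ler_wpM2r ?sqrtr_ge0 // ler_wpM2l ?mulr_ge0 // gG.
rewrite (dotDl (_ + _)) (dotDl (_ - _)).
by move: e1 e2 e3 e4; rewrite !mulrDl; lra.
Qed.

End Geometry.

(** * The first-order decrease of the cost *)

Section Descent.
Context {R : realType} {D : nat} (P : problem R D) (s : sampling R D).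
Hypothesis HP : problem_ok P.
Hypothesis HS : setting_ok P s.
Implicit Types (p q r x y xi v w : 'rV[R]_D).

Local Notation f := (cost P).
Local Notation h := (fillh s).
Local Notation m := (deg P).
Local Notation sqrtD := (Num.sqrt (D%:R : R)).
Local Notation Mt := (Defs.Mt P s).
Local Notation Tt := (Defs.Tt s).
Local Notation agrad := (Defs.agrad P s).
Local Notation retr := (Defs.retr s).
Local Notation proj := (Defs.proj s).
Local Notation Mt_smooth_at := (Defs.Mt_smooth_at P s).
Local Notation alphahat := (Defs.alphahat P s).
Local Notation beta := (Defs.beta P s).

(** The curve [t |-> retr r (t *: (c *: xi))] is a reparametrization of
    [t |-> retr r (t *: xi)], so the correction of [c *: xi] is [c] times that
    of [xi].  Take [c] stretching [xi] to the boundary of the domain. *)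
Lemma vcorr_le r xi : setK P s (r, xi) -> xi != 0 ->
  enorm (derive1 (vcorr s r xi) 0) <= boundLv s / radQ s * enorm xi.
Proof.
move=> K xi0; have [rMt xiT xiQ] := K; rewrite /= in rMt xiT xiQ.
have Q0 := radQ_gt0 HS.
have nxi : 0 < enorm xi.
  by rewrite lt_neqAle enorm_ge0 andbT eq_sym; apply: contra_neq xi0; exact: enorm_eq0.
set c := radQ s / enorm xi.
have c0 : 0 < c by rewrite divr_gt0.
have K' : setK P s (r, c *: xi).
  split; [exact: rMt|exact: (TtZ HS)|].
  by rewrite /= enormZ gtr0_norm // divfK // gt_eqF.
case: HS => _ [_ _ _ [_ _ _ retrP] _].
have [_ _ d1 _ _] := retrP _ _ K.
have [_ _ d2 Lv' _] := retrP _ _ K'.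
set v' := derive1 (vcorr s r xi) 0 in d1 *.
set v1 := derive1 (vcorr s r (c *: xi)) 0 in d2 Lv'.
pose k (t : R) : 'rV[R]_D := retr r (t *: xi).
have dk : differentiable k 0 by apply/derivable1_diffP; apply: ex_derive.
have ke : (fun t : R => retr r (t *: (c *: xi))) = (fun t : R => k (0 + t *: c)).
  by apply: funext => t; rewrite /k add0r scalerA.
have dkc := is_derive_line c dk; rewrite -ke in dkc.
have e : c *: xi + v1 = c *: (xi + v').
  have <- : 'D_1 (fun t : R => retr r (t *: (c *: xi))) 0 = c *: xi + v1.
    exact: derive_val.
  have -> : 'D_1 (fun t : R => retr r (t *: (c *: xi))) 0 = 'D_c k 0.
    exact: derive_val.
  have <- : 'D_1 k 0 = xi + v' by exact: derive_val.
  rewrite !deriveE // -{1}[c]mulr1.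
  exact: linearZ.
have v1E : v1 = c *: v' by move: e; rewrite scalerDr => /addrI.
move: Lv'; rewrite v1E enormZ gtr0_norm // => Lv'.
rewrite -(ler_pM2l c0); apply: le_trans Lv' _.
rewrite (_ : c * _ = boundLv s) //.
by rewrite /c; field; rewrite !gt_eqF.
Qed.

Hypothesis LvQ : 6 * boundLv s <= radQ s.

Section At_regular_point.
Variable r : 'rV[R]_D.
Hypothesis rMt : Mt r.
Hypothesis r_smooth : Mt_smooth_at r.
Hypothesis r_large : threshold P s r <= enorm (agrad r).

Local Notation ag := (agrad r).

Lemma agrad_gt0 : 0 < enorm ag.
Proof.
apply: lt_le_trans r_large; rewrite /threshold lt_max; apply/orP; left.
case: HP => _ [_ [_ [a0 _ _]]]; case: HS => _ [_ _ _ [_ Lv0 _ _] _].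
by rewrite divr_gt0 // mulr_gt0.
Qed.

Lemma beta_ge : 2^-1 <= beta r.
Proof.
have a0 := agrad_gt0.
move: r_large; rewrite /threshold ge_max => /andP[_ lea].
rewrite /Defs.beta lerBrDr -lerBrDl ler_pdivrMr //.
by move: lea; rewrite -!mulrA; lra.
Qed.

Lemma alphahat_gt0 : 0 < alphahat r.
Proof.
case: HP => _ [_ [_ [a0 _ _]]].
by rewrite /Defs.alphahat lt_min a0 divr_gt0 ?(radQ_gt0 HS) ?agrad_gt0.
Qed.

Lemma alphahat_le_radQ a : a <= alphahat r -> a * enorm ag <= radQ s.
Proof.
by rewrite /Defs.alphahat le_min => /andP[_]; rewrite ler_pdivlMr ?agrad_gt0.
Qed.

(** Pair [w] with [ag], where only the error [w - xi] costs, and with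
    [egrad f r - ag], where [normal_part_small] applies.  The slack left is
    [(1/3 - 2/3 (1 - beta)) a |ag|^2], nonnegative since [beta >= 1/2]. *)
Lemma descent_direction xi w a : 0 < a -> xi = - (a *: ag) ->
  tangent_space Mt r w -> enorm (w - xi) <= 6^-1 * enorm xi ->
  dot (egrad f r) w <= - (beta r / 2 * a * enorm ag ^+ 2).
Proof.
move=> a0 xiE wT wxi; have ag0 := agrad_gt0; have b2 := beta_ge.
have nxi : enorm xi = a * enorm ag by rewrite xiE enormN enormZ gtr0_norm.
have [p pM pr] := rMt; have h0 := fillh_gt0 HS.
case: HS => _ [_ [_ _ phitP] _ _ _].
have smp : Mt_smooth_at (proj p) by rewrite pr.
have [lp /(_ 0 (mem0v _))] := phitP p pM smp.
have sm0 : Mt_smooth_at (phit s p 0) by case: lp => ->.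
rewrite enorm0 => /(_ (chart_radius_gt0 HP HS) sm0) [dphi Cphi].
have cMt0 : 0 <= cMt P by case: HP => _ [_ [[]]].
have hm : 0 <= h ^+ m by rewrite exprn_ge0 // ltW.
rewrite pr in lp.
have e1 := normal_part_small HP HS pM pr (mulr_ge0 cMt0 hm) lp dphi Cphi wT.
have e2 := cauchy_schwarz ag (w - xi).
have wn : enorm w <= 7 / 6 * (a * enorm ag).
  rewrite -nxi -[w in leLHS](subrK xi); apply: le_trans (enormD _ _) _; lra.
have -> : dot (egrad f r) w =
    dot (egrad f r - ag) w + (dot ag (w - xi) + dot ag xi).
  by rewrite -dotDr subrK -dotDl subrK.
rewrite {2}xiE dotNr dotZr -enorm_sqr.
set k := cMt P * enorm (egrad f r) * sqrtD * h ^+ m.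
have e1' : dot (egrad f r - ag) w <= k * (7 / 6 * (a * enorm ag)).
  apply: le_trans e1 _.
  rewrite (_ : cMt P * h ^+ m * enorm (egrad f r) * sqrtD = k); last first.
    by rewrite /k; ring.
  by rewrite ler_wpM2l // /k !mulr_ge0 ?sqrtr_ge0 ?enorm_ge0.
have kE : k = (1 - beta r) * enorm ag.
  by rewrite /Defs.beta -/k; field; rewrite gt_eqF.
have e2' : dot ag (w - xi) <= 6^-1 * (a * enorm ag ^+ 2).
  apply: le_trans e2 _.
  apply: (@le_trans _ _ (enorm ag * (6^-1 * enorm xi))).
    by rewrite ler_wpM2l ?enorm_ge0.
  by rewrite nxi le_eqVlt; apply/orP; left; apply/eqP; ring.
have A0 : 0 < a * enorm ag ^+ 2 by rewrite mulr_gt0 // exprn_gt0.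
have e3 : 0 <= (beta r - 2^-1) * (a * enorm ag ^+ 2).
  by rewrite mulr_ge0 ?subr_ge0 // ltW.
move: e1' e2' e3; rewrite kE.
set A := a * enorm ag ^+ 2.
rewrite (_ : (1 - beta r) * enorm ag * (7 / 6 * (a * enorm ag)) =
  7 / 6 * ((1 - beta r) * A)); last by rewrite /A; field.
rewrite -(mulrA (beta r / 2)) -/A; lra.
Qed.

(** The first-order gain of [descent_direction] minus the quadratic error of
    the retraction, for the velocity [xi + v'] with [xi = - (a *: ag)]. *)
Lemma step_decrease a : 0 < a -> a <= alphahat r ->
  a * enorm ag ^+ 2 * (beta r / 2 - Ltilde s / 2 * a) <=
    f r - f (retr r (- (a *: ag))).
Proof.
move=> a0 aah; have ag0 := agrad_gt0.
set xi := - (a *: ag).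
have nxi : enorm xi = a * enorm ag by rewrite enormN enormZ gtr0_norm.
have nxi0 : 0 < enorm xi by rewrite nxi mulr_gt0.
have K : setK P s (r, xi).
  split; [exact: rMt| |by rewrite /= nxi alphahat_le_radQ].
  by rewrite /= /xi -scaleNr; apply: (TtZ HS) => //; apply: (agrad_Tt HS).
have xi0 : xi != 0.
  by apply: contraTneq nxi0 => ->; rewrite enorm0 ltxx.
have vle := vcorr_le K xi0.
case: HS => _ [_ [_ _ phitP] _ [_ _ _ retrP] _].
have [_ _ _ _ /(_ r_smooth) [_ wT tayl]] := retrP _ _ K.
set v' := derive1 _ _ in vle wT tayl.
have Q0 := radQ_gt0 HS.
have v6 : enorm (xi + v' - xi) <= 6^-1 * enorm xi.
  rewrite addrC addKr; apply: le_trans vle _.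
  by rewrite ler_wpM2r ?enorm_ge0 // ler_pdivrMr // ler_pdivlMl.
have dd := descent_direction a0 erefl wT v6.
have [V VE] : exists V : {vspace 'rV[R]_D}, tangent_space Mt r = [set` V].
  have [p pM pr] := rMt.
  have smp : Mt_smooth_at (proj p) by rewrite pr.
  have [lp /(_ 0 (mem0v _))] := phitP p pM smp.
  have sm0 : Mt_smooth_at (phit s p 0) by case: lp => ->.
  rewrite enorm0 => /(_ (chart_radius_gt0 HP HS) sm0) [dphi _].
  rewrite -pr; exact: (tangent_space_linear (chart_radius_gt0 HP HS) lp dphi).
have rg : dot (rgrad Mt f r) (xi + v') = dot (egrad f r) (xi + v').
  by rewrite /rgrad VE dot_orthproj //; move: wT; rewrite VE.
move: tayl; rewrite ler_norml rg nxi => /andP[_ up].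
have e : a * enorm ag ^+ 2 * (beta r / 2 - Ltilde s / 2 * a) =
  beta r / 2 * a * enorm ag ^+ 2 - Ltilde s / 2 * (a * enorm ag) ^+ 2 by ring.
by rewrite e; move: dd up; lra.
Qed.

End At_regular_point.
End Descent.

(** * Backtracking *)

Section Backtracking.
Context {R : realType} {D : nat} (P : problem R D) (s : sampling R D).
Hypothesis HP : problem_ok P.
Hypothesis HS : setting_ok P s.
Hypothesis LvQ : 6 * boundLv s <= radQ s.
Variable r : 'rV[R]_D.
Hypothesis rMt : Mt P s r.
Hypothesis r_smooth : Mt_smooth_at P s r.
Hypothesis r_large : threshold P s r <= enorm (agrad P s r).

Local Notation f := (cost P).
Local Notation Q := (radQ s).
Local Notation ag := (agrad P s r).
Local Notation ah := (alphahat P s r).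
Local Notation bt := (beta P s r).
Local Notation a_safe := (2 * (bt / 2 - delta P) / Ltilde s).
Local Notation next := (fun x => retr s x (- (stepsize P s x *: agrad P s x))).

Let ag0 : 0 < enorm ag := agrad_gt0 HP HS r_large.
Let ah0 : 0 < ah := alphahat_gt0 HP HS r_large.

Let gamma01 : 0 < gamma P < 1.
Proof. by case: HP => _ [_ [_ []]]. Qed.

Let g0 : 0 < gamma P. Proof. by case/andP: gamma01. Qed.

Let delta0 : 0 < delta P < 4^-1.
Proof. by case: HP => _ [_ [_ []]]. Qed.

Let Lt0 : 0 < Ltilde s.
Proof. by case: HS => _ [_ _ _ []]. Qed.

Lemma beta_delta_gt0 : 4^-1 - delta P <= bt / 2 - delta P /\ 0 < 4^-1 - delta P.
Proof.
have b := beta_ge HP HS r_large; case/andP: delta0 => _ d4.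
by split; lra.
Qed.

Lemma a_safe_gt0 : 0 < a_safe.
Proof. by have [? ?] := beta_delta_gt0; rewrite divr_gt0 // mulr_gt0 //; lra. Qed.

Lemma bt_continue_large a : 0 < a -> a <= ah -> bt_continue P s r a -> a_safe < a.
Proof.
move=> a0 aah; rewrite ltNge => btc; apply/negP => asafe.
have := step_decrease HP HS LvQ rMt r_smooth r_large a0 aah.
apply/negP; rewrite -ltNge; apply: lt_le_trans btc _.
rewrite -mulrA [delta P * _]mulrC ler_wpM2l //.
  by rewrite mulr_ge0 ?ltW // exprn_gt0.
by move: asafe; rewrite ler_pdivlMr //; lra.
Qed.

Lemma trial_step_range k : 0 < ah * gamma P ^+ k <= ah.
Proof.
rewrite mulr_gt0 ?exprn_gt0 //= ger_pMr // exprn_ile1 // ltW //.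
by case/andP: gamma01.
Qed.

(** Trial steps decrease geometrically, hence eventually drop below the safe
    step. *)
Lemma bt_stops_exists : exists k, bt_stops P s r k.
Proof.
have [n gn] : exists n, ah * gamma P ^+ n <= a_safe.
  have /cvgrPdist_lt : (fun n => gamma P ^+ n) @ \oo --> (0 : R).
    by apply: cvg_expr; rewrite gtr0_norm //; case/andP: gamma01.
  move=> /(_ (a_safe / ah)) [|n _ /(_ n (leqnn n))].
    by rewrite divr_gt0 // a_safe_gt0.
  rewrite sub0r normrN gtr0_norm ?exprn_gt0 // => gn.
  by exists n; rewrite mulrC -ler_pdivlMr // ltW.
have ex : exists n, `[< ~ bt_continue P s r (ah * gamma P ^+ n) >].
  exists n; apply/asboolP => btc.
  have /andP[a1 a2] := trial_step_range n.
  by have := bt_continue_large a1 a2 btc; rewrite ltNge gn.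
case: (ex_minnP ex) => k /asboolP kstop kmin; exists k; split=> // j jk.
apply: contrapT => nj; have := kmin j (introT (asboolP _) nj).
by rewrite leqNgt jk.
Qed.

Lemma bt_stops_prev k : bt_stops P s r k.+1 -> a_safe < ah * gamma P ^+ k.
Proof.
case=> _ /(_ k (leqnn _)) btc; have /andP[a1 a2] := trial_step_range k.
exact: bt_continue_large btc.
Qed.

(** After [k > 0] reductions the last rejected trial [ah * gamma ^ (k - 1)]
    exceeds the safe step, that is,
    [gamma ^ -k < ah * Ltilde / (2 gamma (bt / 2 - delta))]; take logarithms. *)
Lemma bt_stops_evals k : bt_stops P s r k -> k.+1%:R <= max_evals P s r.
Proof.
rewrite /max_evals le_max; case: k => [|k] st; first by rewrite lexx.
have safe := bt_stops_prev st; apply/orP; right.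
have bd0 : 0 < bt / 2 - delta P by have [? ?] := beta_delta_gt0; lra.
have gi1 : 1 < (gamma P)^-1 by rewrite invf_gt1 //; case/andP: gamma01.
have lg0 : 0 < ln (gamma P)^-1 by rewrite ln_gt0.
set X := ah * _ / _.
have gX : (gamma P)^-1 ^+ k.+1 < X.
  rewrite exprVn /X.
  have gk : 0 < gamma P ^+ k.+1 by rewrite exprn_gt0.
  rewrite -[X in X < _]mul1r ltr_pdivrMr // mulrAC ltr_pdivlMr; last first.
    by rewrite !mulr_gt0.
  move: safe; rewrite ltr_pdivrMr // => safe.
  have := safe; rewrite -(ltr_pM2l g0) => {}safe.
  rewrite mul1r; apply: le_lt_trans (lt_le_trans safe _).
    by rewrite le_eqVlt; apply/orP; left; apply/eqP; ring.
  by rewrite le_eqVlt; apply/orP; left; apply/eqP; rewrite exprS; ring.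
have lX : k.+1%:R <= ln X / ln (gamma P)^-1.
  rewrite ler_pdivlMr // mulr_natl -lnXn ?invr_gt0 //.
  rewrite ler_ln ?posrE ?exprn_gt0 ?invr_gt0 //; first exact: ltW.
  by apply: lt_trans gX; rewrite exprn_gt0 // invr_gt0.
by apply: le_trans (lerD (lexx 2) lX); rewrite -[k.+2]add1n natrD lerD2r ler1n.
Qed.

(** The accepted step is either the initial one or [gamma] times a rejected
    one, hence at least [gamma] times the safe step. *)
Lemma stepsize_spec :
  [/\ 0 < stepsize P s r, stepsize P s r <= ah,
      Num.min ah (gamma P * a_safe) <= stepsize P s r
    & delta P * stepsize P s r * enorm ag ^+ 2 <= f r - f (next r)].
Proof.
have [k0 st0] := bt_stops_exists.
have st : bt_stops P s r (xget 0%N (bt_stops P s r)) by exact: xgetPex (ex_intro _ _ st0).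
rewrite /stepsize; move: (xget _ _) st => k st; split.
- by case/andP: (trial_step_range k).
- by case/andP: (trial_step_range k).
- case: k st => [|k] st; first by rewrite expr0 mulr1 ge_min lexx.
  have /ltW safe := bt_stops_prev st.
  by rewrite ge_min exprS mulrCA ler_pM2l // safe orbT.
- by case: st => /negP; rewrite -leNgt.
Qed.

Lemma next_Mt : Mt P s (next r).
Proof.
have [sp sah _ _] := stepsize_spec.
apply: (retr_Mt HS) => //.
  by rewrite -scaleNr; apply: (TtZ HS) => //; apply: (agrad_Tt HS).
rewrite enormN enormZ gtr0_norm //.
exact: (alphahat_le_radQ HP HS).
Qed.

Lemma next_decrease :
  delta P * Num.min (stepmin P s * enorm ag ^+ 2) (Q * enorm ag) <=
    f r - f (next r).
Proof.
have [sp sah smin dec] := stepsize_spec; apply: le_trans dec.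
case/andP: delta0 => d0 _; rewrite -mulrA ler_wpM2l ?(ltW d0) //.
apply: (@le_trans _ _ (Num.min ah (gamma P * a_safe) * enorm ag ^+ 2)); last first.
  by rewrite ler_wpM2r // exprn_ge0 // ltW.
have [bd _] := beta_delta_gt0.
have cs : 2 * gamma P * (4^-1 - delta P) / Ltilde s <= gamma P * a_safe.
  rewrite (_ : gamma P * a_safe = 2 * gamma P * (bt / 2 - delta P) / Ltilde s).
    by rewrite ler_pM2r ?invr_gt0 // ler_pM2l ?mulr_gt0.
  by ring.
have ag2 : 0 < enorm ag ^+ 2 by rewrite exprn_gt0.
have sm1 : stepmin P s <= alphabar P by rewrite /stepmin ge_min lexx.
have sm2 : stepmin P s <= 2 * gamma P * (4^-1 - delta P) / Ltilde s.
  by rewrite /stepmin ge_min lexx orbT.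
move: (stepmin P s) sm1 sm2 => sm sm1 sm2.
rewrite /alphahat !minr_pMl ?(ltW ag2) // !le_min; apply/andP; split.
  apply/andP; split; first by rewrite ge_min ler_pM2r // sm1.
  rewrite ge_min; apply/orP; right; rewrite le_eqVlt; apply/orP; left.
  by apply/eqP; field; rewrite gt_eqF.
by rewrite ge_min ler_pM2r // (le_trans sm2 cs).
Qed.

End Backtracking.

(** * Counting iterations *)

Section Run.
Context {R : realType} {D : nat} (P : problem R D) (s : sampling R D).
Hypothesis HP : problem_ok P.
Hypothesis HS : setting_ok P s.
Implicit Types (p x : 'rV[R]_D) (e g eps : R).

Local Notation f := (cost P).
Local Notation Q := (radQ s).
Local Notation ag := (agrad P s).

(** The decrease of the cost, up to the factor [delta P], that one iteration
    guarantees at a point whose approximate gradient has norm [g]. *)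
Definition guaranteed_decrease g : R := Num.min (stepmin P s * g ^+ 2) (Q * g).

Lemma delta_gt0 : 0 < delta P.
Proof. by case: HP => _ [_ [_ [_ _ /andP[]]]]. Qed.

Lemma stepmin_gt0 : 0 < stepmin P s.
Proof.
case: HP => _ [_ [_ [a0 /andP[g0 _] /andP[_ d4]]]].
case: HS => _ [_ _ _ [_ _ Lt0 _] _].
by rewrite /stepmin lt_min a0 divr_gt0 // !mulr_gt0 // subr_gt0.
Qed.

Lemma guaranteed_decrease_gt0 g : 0 < g -> 0 < guaranteed_decrease g.
Proof.
move=> g0; have Q0 := radQ_gt0 HS; have sm0 := stepmin_gt0.
by rewrite /guaranteed_decrease lt_min !mulr_gt0 // exprn_gt0.
Qed.

Lemma guaranteed_decrease_lt e g : 0 < e -> e < g ->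
  guaranteed_decrease e < guaranteed_decrease g.
Proof.
move=> e0 eg; have Q0 := radQ_gt0 HS; have sm0 := stepmin_gt0.
rewrite /guaranteed_decrease lt_min !gt_min !ltr_pM2l // eg orbT andbT.
by rewrite ltr_pXn2r ?nnegrE ?eg // ltW // (lt_trans e0).
Qed.

Lemma guaranteed_decrease_le e g : 0 < e -> e <= g ->
  guaranteed_decrease e <= guaranteed_decrease g.
Proof.
move=> e0; rewrite le_eqVlt => /predU1P[-> //|eg].
exact/ltW/guaranteed_decrease_lt.
Qed.

Lemma fstar_le x : Mt P s x -> fstar P <= f x.
Proof. by case: HS => _ [_ _ _ _ [_ _ H _]] xMt; apply: H; right. Qed.

Lemma eps4_gt eps x : eps < eps4 P s eps x.
Proof.
rewrite /eps4 ltrDr /threshold lt_max; apply/orP; left.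
case: HP => _ [_ [_ [a0 _ _]]]; case: HS => _ [_ _ _ [_ Lv0 _ _] _].
by rewrite divr_gt0 // mulr_gt0.
Qed.

(** The case distinction of [max_iterations] is the one between the two
    arguments of the minimum in [guaranteed_decrease]. *)
Lemma max_iterationsE x0 e : 0 < e ->
  max_iterations P s x0 e =
  Num.ceil ((f x0 - fstar P) / (delta P * guaranteed_decrease e)).
Proof.
move=> e0; have Q0 := radQ_gt0 HS; have sm0 := stepmin_gt0; have d0 := delta_gt0.
have cmp : (Q / stepmin P s < e) = (Q * e < stepmin P s * e ^+ 2).
  by rewrite ltr_pdivrMr // -(ltr_pM2r e0) (mulrC e) -mulrA -expr2.
rewrite /max_iterations /guaranteed_decrease cmp.
move: (stepmin P s) sm0 => sm sm0; case: ltP => _; congr Num.ceil; field;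
  by rewrite !gt_eqF.
Qed.

Lemma bound_a_bound_b eps x : Mt P s x ->
  bound_a_holds P s eps x -> bound_b_holds P s eps x.
Proof.
move=> xMt ax; case: (HS) => _ [_ [prox _ _] _ _ [_ _ _ gG]].
split; first exact: gG.
move=> p pM px; split; last by rewrite -px enormB_sym; exact: prox.
apply: le_trans (rgrad_le HP HS pM px) _.
by rewrite /bound_b lerD2l.
Qed.

Section From_x0.
Variables (x0 : 'rV[R]_D) (N : nat).
Hypothesis run : run_ok P s x0 N.

Local Notation xs := (iterate P s x0).

Lemma run_step i : (i < maxn N 1)%N -> Mt P s (xs i) ->
  [/\ Mt P s (xs i.+1), f (xs i.+1) <= f (xs i) &
      delta P * guaranteed_decrease (enorm (ag (xs i))) <= f (xs i) - f (xs i.+1)].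
Proof.
case: run => _ LvQ pts iN xMt; have [sm lg] := pts i iN.
have dec := next_decrease HP HS LvQ xMt sm lg.
split => //; first exact: (next_Mt HP HS LvQ).
rewrite -subr_ge0; apply: le_trans dec; rewrite ltW // mulr_gt0 ?delta_gt0 //.
exact/guaranteed_decrease_gt0/(agrad_gt0 HP HS lg).
Qed.

Lemma iterate_Mt i : (i <= maxn N 1)%N -> Mt P s (xs i).
Proof.
elim: i => [|i IH] iN; first by case: run.
by have [] := run_step iN (IH (ltnW iN)).
Qed.

Lemma iterate_cost_le i : (i <= maxn N 1)%N -> f (xs i) <= f x0.
Proof.
elim: i => [//|i IH] iN.
have [_ le1 _] := run_step iN (iterate_Mt (ltnW iN)).
exact: le_trans le1 (IH (ltnW iN)).
Qed.

Lemma total_decrease g i : 0 < g -> (i <= maxn N 1)%N ->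
  (forall j, (j < i)%N -> g <= enorm (ag (xs j))) ->
  i%:R * (delta P * guaranteed_decrease g) <= f x0 - f (xs i).
Proof.
move=> g0; elim: i => [|i IH] iN ge_g; first by rewrite mul0r subrr.
have IHi := IH (ltnW iN) (fun j ji => ge_g j (ltnW ji)).
have [_ _ dec] := run_step iN (iterate_Mt (ltnW iN)).
have dg : delta P * guaranteed_decrease g <=
          delta P * guaranteed_decrease (enorm (ag (xs i))).
  by rewrite ler_wpM2l ?(ltW delta_gt0) // guaranteed_decrease_le // ge_g.
rewrite -natr1 mulrDl mul1r; lra.
Qed.

Lemma output_spec :
  exists2 i, (i <= N)%N & output P s x0 N = xs i /\
    forall j, (j <= N)%N -> enorm (ag (xs i)) <= enorm (ag (xs j)).
Proof.
rewrite /output; case: arg_minP => // i _ imin.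
exists (nat_of_ord i); first exact: (ltn_ord i).
split; first reflexivity.
by move=> j jN; exact: (imin (Ordinal (jN : (j < N.+1)%N)) isT).
Qed.

(** A run of length 0 also obeys this bound: its hypotheses still allow one
    descent step from [x0], which forces [fstar < f x0].  Hence the count
    below goes up to [maxn N 1]. *)
Lemma run_length_lt e : 0 < e -> e < enorm (ag (output P s x0 N)) ->
  N%:R * (delta P * guaranteed_decrease e) < f x0 - fstar P.
Proof.
move=> e0; have [i iN [-> imin]] := output_spec; set g := enorm _ => eg.
have g0 := lt_trans e0 eg.
have lt_eg : delta P * guaranteed_decrease e < delta P * guaranteed_decrease g.
  by rewrite ltr_pM2l ?delta_gt0 // guaranteed_decrease_lt.
(* [K = N] except that [K = 1] when [N = 0]; either way [0 < K], which keeps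
   the inequality strict. *)
pose K := maxn N 1.
have K0 : (0 < K)%N by rewrite /K leq_max orbT.
have := @total_decrease g K g0 (leqnn _).
have fK := fstar_le (iterate_Mt (leqnn K)).
move=> H; apply: (@lt_le_trans _ _ (K%:R * (delta P * guaranteed_decrease g))).
  apply: (@le_lt_trans _ _ (K%:R * (delta P * guaranteed_decrease e))).
    rewrite ler_wpM2r ?ler_nat ?leq_maxl // ltW // mulr_gt0 ?delta_gt0 //.
    exact: guaranteed_decrease_gt0.
  by rewrite ltr_pM2l // ltr0n.
apply: (@le_trans _ _ (f x0 - f (xs K))); last by rewrite lerD2l lerN2.
apply: H => j jK; apply: imin; move: jK.
by rewrite /K leq_max => /orP[/ltnW //|]; rewrite ltnS leqn0 => /eqP ->.
Qed.

Lemma bound_a_of_length eps e : 0 < e ->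
  e <= eps4 P s eps (output P s x0 N) ->
  f x0 - fstar P <= N%:R * (delta P * guaranteed_decrease e) ->
  bound_a_holds P s eps (output P s x0 N).
Proof.
move=> e0 ee len; rewrite /bound_a_holds leNgt; apply/negP => lt_eg.
by have := run_length_lt e0 (le_lt_trans ee lt_eg); rewrite ltNge len.
Qed.

End From_x0.

End Run.

(** * Vanishing fill distance *)

(** The upper bound no longer mentions the point: [boundG] does not depend on
    the sampling, so this is uniform along a sequence of samplings. *)
Lemma threshold_le (R : realType) (D : nat) (P : problem R D) (s : sampling R D) x :
  problem_ok P -> setting_ok P s -> Mt P s x ->
  0 <= threshold P s x <= 6 * boundLv s / alphabar P +
    2 * cMt P * boundG P * Num.sqrt D%:R * fillh s ^+ deg P.
Proof.
move=> HP HS xMt.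
have h0 := fillh_gt0 HS.
case: HP => _ [_ [[_ _ c0] [a0 _ _]]].
case: HS => _ [_ _ _ [_ Lv0 _ _] [_ _ _ gG]].
have A0 : 0 <= 6 * boundLv s / alphabar P by rewrite ltW // divr_gt0 // mulr_gt0.
have h1 : 0 <= fillh s ^+ deg P by rewrite exprn_ge0 // ltW.
have gx : 2 * cMt P * enorm (egrad (cost P) x) * Num.sqrt D%:R * fillh s ^+ deg P <=
  2 * cMt P * boundG P * Num.sqrt D%:R * fillh s ^+ deg P.
  by rewrite ler_wpM2r // ler_wpM2r ?sqrtr_ge0 // ler_wpM2l ?gG // mulr_ge0.
have g0 : 0 <= 2 * cMt P * enorm (egrad (cost P) x) * Num.sqrt D%:R * fillh s ^+ deg P.
  by rewrite !mulr_ge0 ?sqrtr_ge0.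
rewrite /threshold le_max A0 /= ge_max lerDl (le_trans g0 gx) /=.
by apply: le_trans gx _; rewrite lerDr.
Qed.

Lemma cvg_exprn (R : realType) (u : nat -> R) (l : R) n :
  u @ \oo --> l -> (fun k => u k ^+ n) @ \oo --> l ^+ n.
Proof.
move=> ul; elim: n => [|n IH].
  by under eq_fun do rewrite expr0; rewrite expr0; exact: cvg_cst.
by under eq_fun do rewrite exprS; rewrite exprS; exact: cvgM.
Qed.

Theorem theorem27 (R : realType) (D : nat) (P : problem R D)
    (HP : problem_ok P) (eps : R) (Heps : 0 < eps) :
  (* one sample set *)
  (forall (s : sampling R D) (x0 : 'rV[R]_D), setting_ok P s ->
    (exists N0 : nat, forall N, (N0 <= N)%N -> run_ok P s x0 N ->
       bound_a_holds P s eps (output P s x0 N) /\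
       bound_b_holds P s eps (output P s x0 N)) /\
    (forall N, run_ok P s x0 N ->
      let x := output P s x0 N in
      [/\ Mt P s x,
          cost P x <= cost P x0,
          (max_iterations P s x0 (eps4 P s eps x) <= N%:Z ->
             bound_a_holds P s eps x /\ bound_b_holds P s eps x)
        & forall i, (i < N)%N ->
            let xi := iterate P s x0 i in
            [/\ 0 < alphahat P s xi, 0 < beta P s xi &
                exists2 k : nat, bt_stops P s xi k &
                  k.+1%:R <= max_evals P s xi]])) /\
  (* fill distance tending to 0 *)
  (forall (s : nat -> sampling R D) (x0 : nat -> 'rV[R]_D) (N : nat -> nat),
    (forall k, setting_ok P (s k) /\ run_ok P (s k) (x0 k) (N k)) ->
    (fun k => fillh (s k)) @ \oo --> (0 : R) ->
    (fun k => boundLv (s k)) @ \oo --> (0 : R) ->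
    [/\ (fun k => bound_b P (s k) eps (output P (s k) (x0 k) (N k)))
          @ \oo --> eps,
        (fun k => 6 * boundLv (s k)) @ \oo --> (0 : R)
      & forall i : nat -> nat, (forall k, (i k <= N k)%N) ->
          (fun k => threshold P (s k) (iterate P (s k) (x0 k) (i k)))
            @ \oo --> (0 : R)]).
Proof.
split.
  move=> s x0 HS.
  have out_Mt N : run_ok P s x0 N -> Mt P s (output P s x0 N).
    move=> run; have [i iN [-> _]] := output_spec P s x0 N.
    by apply: (iterate_Mt HP HS run); rewrite leq_max iN.
  split.
    exists (Num.bound `|(cost P x0 - fstar P) / (delta P * guaranteed_decrease P s eps)|).
    move=> N N0 run.
    suff a : bound_a_holds P s eps (output P s x0 N).
      by split=> //; apply: (bound_a_bound_b HP HS) => //; exact: out_Mt.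
    apply: (bound_a_of_length HP HS run Heps).
      exact/ltW/eps4_gt.
    rewrite -ler_pdivrMr; last first.
      by rewrite mulr_gt0 ?(delta_gt0 HP) ?guaranteed_decrease_gt0.
    apply: le_trans (ler_norm _) _; apply: ltW.
    by apply: lt_le_trans (archi_boundP (normr_ge0 _)) _; rewrite ler_nat.
  move=> N run; have [i iN [outE _]] := output_spec P s x0 N; split.
  - exact: out_Mt.
  - by rewrite outE; apply: (iterate_cost_le HP HS run); rewrite leq_max iN.
  - set x := output _ _ _ _ => len.
    have e0 : 0 < eps4 P s eps x by apply: lt_trans Heps _; exact: eps4_gt.
    suff a : bound_a_holds P s eps x.
      by split=> //; apply: (bound_a_bound_b HP HS) => //; exact: out_Mt.
    apply: (bound_a_of_length HP HS run e0 (lexx _)).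
    rewrite -ler_pdivrMr; last first.
      by rewrite mulr_gt0 ?(delta_gt0 HP) ?guaranteed_decrease_gt0.
    apply: le_trans (ceil_ge _) _.
    by move: len; rewrite max_iterationsE // -(ler_int R).
  - move=> j jN xj.
    have jK : (j < maxn N 1)%N by rewrite leq_max jN.
    have xMt := iterate_Mt HP HS run (ltnW jK).
    have [_ LvQ /(_ j jK) [sm lg]] := run.
    have [k st] := bt_stops_exists HP HS LvQ xMt sm lg.
    split; first exact: (alphahat_gt0 HP HS lg).
      by apply: lt_le_trans (beta_ge HP HS lg); rewrite invr_gt0.
    by exists k => //; exact: (bt_stops_evals HP HS LvQ xMt sm lg).
move=> s x0 N H h0 Lv0.
have hm0 : (fun k => fillh (s k) ^+ deg P) @ \oo --> (0 : R).
  have m0 : (0 < deg P)%N by case: HP => [[]].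
  have := @cvg_exprn _ _ _ (deg P) h0; rewrite expr0n.
  by rewrite gtn_eqF.
have Lv60 : (fun k => 6 * boundLv (s k)) @ \oo --> (0 : R).
  by rewrite -[X in _ --> X](mulr0 6);
      apply: cvgM => //; exact: cvg_cst.
have thr0 (i : nat -> nat) : (forall k, (i k <= N k)%N) ->
    (fun k => threshold P (s k) (iterate P (s k) (x0 k) (i k))) @ \oo --> (0 : R).
  move=> iN.
  apply: (@squeeze_cvgr _ _ _ _ (fun=> 0) (fun k => 6 * boundLv (s k) / alphabar P +
    2 * cMt P * boundG P * Num.sqrt D%:R * fillh (s k) ^+ deg P)).
  - apply: nearW => k; have [HS run] := H k.
    apply: threshold_le => //; apply: (iterate_Mt HP HS run).
    by rewrite leq_max iN.
  - exact: cvg_cst.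
  - rewrite -[X in _ --> X]addr0; apply: cvgD.
      by rewrite -[X in _ --> X](mul0r (alphabar P)^-1);
      apply: cvgM => //; exact: cvg_cst.
    by rewrite -[X in _ --> X](mulr0 (2 * cMt P * boundG P * Num.sqrt D%:R));
      apply: cvgM => //; exact: cvg_cst.
split=> //.
have /choice[i iP] k : exists j, (j <= N k)%N /\
    output P (s k) (x0 k) (N k) = iterate P (s k) (x0 k) j.
  by have [j jN [oE _]] := output_spec P (s k) (x0 k) (N k); exists j.
have thr : (fun k => threshold P (s k) (output P (s k) (x0 k) (N k))) @ \oo --> (0 : R).
  under eq_fun do rewrite (iP _).2.
  exact: (thr0 i (fun k => (iP k).1)).
suff : (fun k => bound_b P (s k) eps (output P (s k) (x0 k) (N k))) @ \oo
    --> (0 : R) + (0 + eps) by rewrite !add0r.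
apply: cvgD; last by apply: cvgD => //; exact: cvg_cst.
by rewrite -[X in _ --> X](mulr0 ((cM P * boundG P + cMMLS P) * Num.sqrt D%:R));
      apply: cvgM => //; exact: cvg_cst.
Qed.
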